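(* For fixed integers $s,t$ and fixed $x,y>0$, $$\lim_{M,N\to\infty}\frac{1}{M^{1/\eta}N^{1/\theta}}K_c\!\left(s,\frac{x}{M^{1/\eta}N^{1/\theta}};t,\frac{y}{M^{1/\eta}N^{1/\theta}}\right)=K_{he}(s,x;t,y),$$ where $M,N\to\infty$ independently (with $M\le N$).
   Context: Fix $\alpha\ge0$, $\eta,\theta>0$. $s^+=\max(s,0)$, $s^-=\max(-s,0)$; $(u)_n=\prod_{0\le i<n}(u+i)$. For integers $1\le M\le N$, $$F_c(s,\zeta)=\frac{\theta^{N-s^+}}{\eta^{M-s^-}}\frac{(\frac{\alpha}{2\theta}+\frac{\zeta}{\theta}+s^++\frac12)_{N-s^+}}{(\frac{\alpha}{2\eta}-\frac{\zeta}{\eta}+s^-+\frac12)_{M-s^-}},\qquad F_{he}(s,\zeta)=\frac{\eta^{s^-}}{\theta^{s^+}}\frac{\Gamma(\frac{\alpha}{2\eta}-\frac{\zeta}{\eta}+s^-+\frac12)}{\Gamma(\frac{\alpha}{2\theta}+\frac{\zeta}{\theta}+s^++\frac12)}.$$ Fix $0<\delta<(\alpha+\min(\eta,\theta))/2$. $\Gamma_+$: ray from $+\infty-i\delta$ to $\delta-i\delta$, segment to $\delta+i\delta$, ray to $+\infty+i\delta$. $\Gamma_-$: ray from $-\infty-i\delta$ to $-\delta-i\delta$, segment to $-\delta+i\delta$, ray to $-\infty+i\delta$. For integers $s>t$, $R_c(s,t;\zeta)=\eta^{s^--t^-}\theta^{t^+-s^+}/[(\frac{\alpha}{2\theta}+\frac{\zeta}{\theta}+t^++\frac12)_{s^+-t^+}(\frac{\alpha}{2\eta}-\frac{\zeta}{\eta}+s^-+\frac12)_{t^--s^-}]$,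 with poles $p^-_i=-\frac\alpha2-\theta(t^++i+\frac12)$ ($0\le i<s^+-t^+$) and $p^+_i=\frac\alpha2+\eta(s^-+i+\frac12)$ ($0\le i<t^--s^-$). $V_c(s,x;t,y)$ ($x,y>0$) is $0$ if $s\le t$; for $s>t$ it is $(xy)^{-1/2}\frac1{2\pi i}\oint(x/y)^\zeta R_c(s,t;\zeta)d\zeta$ over a counterclockwise contour around all $p^-_i$ (no $p^+_i$) if $x>y$, and over a clockwise contour around all $p^+_i$ (no $p^-_i$) if $x\le y$. $$K_c(s,x;t,y)=\frac{1}{\sqrt{xy}}\int_{\Gamma_+}\frac{d\zeta}{2\pi i}\int_{\Gamma_-}\frac{d\omega}{2\pi i}\frac{F_c(s,\zeta)}{F_c(t,\omega)}\frac{x^\zeta}{y^\omega}\frac{1}{\zeta-\omega}-V_c(s,x;t,y)\quad(x,y\in(0,1)),$$ $$K_{he}(s,x;t,y)=\frac{1}{\sqrt{xy}}\int_{\Gamma_+}\frac{d\zeta}{2\pi i}\int_{\Gamma_-}\frac{d\omega}{2\pi i}\frac{F_{he}(s,\zeta)}{F_{he}(t,\omega)}\frac{x^\zeta}{y^\omega}\frac{1}{\zeta-\omega}-V_c(s,x;t,y)\quad(x,y>0).$$ ($K_c$ is the correlation kernel of the continuous Muttalib--Borodin process with parameters $\alpha,\eta,\theta,M,N$.) *)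

(* Defs.v *)
From Stdlib Require Import Reals ZArith ClassicalEpsilon.
From Coquelicot Require Import Coquelicot.
Open Scope R_scope.

(* limit of a C-valued sequence (arbitrary value if it does not exist) *)
Definition Clim_seq (u : nat -> C) : C :=
  epsilon (inhabits (RtoC 0)) (fun l => filterlim u eventually (locally l)).

Definition Clim_pinfty (g : R -> C) : C :=
  epsilon (inhabits (RtoC 0)) (fun l => filterlim g (Rbar_locally p_infty) (locally l)).
Definition Clim_minfty (g : R -> C) : C :=
  epsilon (inhabits (RtoC 0)) (fun l => filterlim g (Rbar_locally m_infty) (locally l)).

Definition CInt (f : R -> C) (a b : R) : C :=
  @RInt C_R_CompleteNormedModule f a b.

Definition CInt_pinfty (f : R -> C) (a : R) : C := Clim_pinfty (fun T => CInt f a T).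
Definition CInt_minfty (f : R -> C) (b : R) : C := Clim_minfty (fun T => CInt f T b).

Definition cexp (z : C) : C :=
  (exp (Re z) * cos (Im z), exp (Re z) * sin (Im z)).

Definition cpowr (x : R) (z : C) : C := cexp (Cmult z (RtoC (ln x))).

Fixpoint pochn (u : C) (n : nat) : C :=
  match n with
  | O => RtoC 1
  | S k => Cmult (pochn u k) (Cplus u (RtoC (INR k)))
  end.
(* integer index: empty product (= 1) when n <= 0 *)
Definition poch (u : C) (n : Z) : C := pochn u (Z.to_nat n).

(* Euler's Gamma function on C, Gauss's product definition
   Gamma z = lim_n n^z n! / (z (z+1) ... (z+n)) *)
Definition CGamma (z : C) : C :=
  Clim_seq (fun n => Cdiv (Cmult (cpowr (INR n) z) (RtoC (INR (fact n))))
                           (pochn z (S n))).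

Definition zpos (s : Z) : Z := Z.max s 0.
Definition zneg (s : Z) : Z := Z.max (- s) 0.

(* Gamma_+ : +oo - i d -> d - i d -> d + i d -> +oo + i d *)
Definition int_Gplus (d : R) (g : C -> C) : C :=
  Cplus (Cplus
    (Copp (CInt_pinfty (fun u => g (u, - d)) d))
    (CInt (fun v => Cmult (g (d, v)) Ci) (- d) d))
    (CInt_pinfty (fun u => g (u, d)) d).

(* Gamma_- : -oo - i d -> -d - i d -> -d + i d -> -oo + i d *)
Definition int_Gminus (d : R) (g : C -> C) : C :=
  Cplus (Cplus
    (CInt_minfty (fun u => g (u, - d)) (- d))
    (CInt (fun v => Cmult (g (- d, v)) Ci) (- d) d))
    (Copp (CInt_minfty (fun u => g (u, d)) (- d))).

Definition int_circle (c r : R) (g : C -> C) : C :=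
  CInt (fun phi => Cmult (g (c + r * cos phi, r * sin phi))
                         (Cmult Ci (r * cos phi, r * sin phi))) 0 (2 * PI).

Definition zC (n : Z) : C := RtoC (IZR n).
Definition half : C := RtoC (/ 2).

Definition F_c (alpha eta theta : R) (M N : nat) (s : Z) (z : C) : C :=
  Cdiv
    (Cmult (RtoC (powerRZ theta (Z.of_nat N - zpos s)))
       (poch (Cplus (Cplus (Cplus (RtoC (alpha / (2 * theta))) (Cdiv z (RtoC theta)))
                            (zC (zpos s))) half)
             (Z.of_nat N - zpos s)))
    (Cmult (RtoC (powerRZ eta (Z.of_nat M - zneg s)))
       (poch (Cplus (Cplus (Cminus (RtoC (alpha / (2 * eta))) (Cdiv z (RtoC eta)))
                            (zC (zneg s))) half)
             (Z.of_nat M - zneg s))).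

Definition F_he (alpha eta theta : R) (s : Z) (z : C) : C :=
  Cmult (RtoC (powerRZ eta (zneg s) / powerRZ theta (zpos s)))
    (Cdiv
       (CGamma (Cplus (Cplus (Cminus (RtoC (alpha / (2 * eta))) (Cdiv z (RtoC eta)))
                             (zC (zneg s))) half))
       (CGamma (Cplus (Cplus (Cplus (RtoC (alpha / (2 * theta))) (Cdiv z (RtoC theta)))
                             (zC (zpos s))) half))).

Definition R_c (alpha eta theta : R) (s t : Z) (z : C) : C :=
  Cdiv (RtoC (powerRZ eta (zneg s - zneg t) * powerRZ theta (zpos t - zpos s)))
    (Cmult
       (poch (Cplus (Cplus (Cplus (RtoC (alpha / (2 * theta))) (Cdiv z (RtoC theta)))
                            (zC (zpos t))) half)
             (zpos s - zpos t))
       (poch (Cplus (Cplus (Cminus (RtoC (alpha / (2 * eta))) (Cdiv z (RtoC eta)))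
                            (zC (zneg s))) half)
             (zneg t - zneg s))).

(* V_c: for s > t, a counterclockwise circle enclosing exactly the poles
   p^-_i = -alpha/2 - theta (t^+ + i + 1/2), 0 <= i < s^+ - t^+  (if x > y),
   resp. a clockwise circle enclosing exactly the poles
   p^+_i = alpha/2 + eta (s^- + i + 1/2), 0 <= i < t^- - s^-  (if x <= y). *)
Definition V_c (alpha eta theta : R) (s : Z) (x : R) (t : Z) (y : R) : C :=
  if Z.leb s t then RtoC 0 else
  Cmult (RtoC (/ sqrt (x * y)))
   (Cmult (Cinv (Cmult (RtoC (2 * PI)) Ci))
    (let g := fun z => Cmult (cpowr (x / y) z) (R_c alpha eta theta s t z) in
     if Rlt_dec y x then
       int_circle (- alpha / 2 - theta * IZR (zpos t + zpos s) / 2)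
                  (theta * IZR (zpos s - zpos t) / 2) g
     else
       Copp (int_circle (alpha / 2 + eta * IZR (zneg s + zneg t) / 2)
                        (eta * IZR (zneg t - zneg s) / 2) g))).

Definition Kdouble (d : R) (Fr : C -> C -> C) (x y : R) : C :=
  Cmult (RtoC (/ sqrt (x * y)))
   (Cmult (Cinv (Cmult (RtoC (2 * PI)) Ci))
    (int_Gplus d (fun z =>
       Cmult (Cinv (Cmult (RtoC (2 * PI)) Ci))
        (int_Gminus d (fun w =>
           Cdiv (Cmult (Fr z w) (Cdiv (cpowr x z) (cpowr y w))) (Cminus z w)))))).

Definition K_c (alpha eta theta d : R) (M N : nat) (s : Z) (x : R) (t : Z) (y : R) : C :=
  Cminus
    (Kdouble d (fun z w => Cdiv (F_c alpha eta theta M N s z) (F_c alpha eta theta M N t w)) x y)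
    (V_c alpha eta theta s x t y).

Definition K_he (alpha eta theta d : R) (s : Z) (x : R) (t : Z) (y : R) : C :=
  Cminus
    (Kdouble d (fun z w => Cdiv (F_he alpha eta theta s z) (F_he alpha eta theta t w)) x y)
    (V_c alpha eta theta s x t y).

(* Main.v *)
Require Import Defs.
From Stdlib Require Import Reals ZArith Lra Lia ClassicalEpsilon FunctionalExtensionality.
From Coquelicot Require Import Coquelicot.
Open Scope R_scope.

(** The term [V_c] is exactly homogeneous under the scaling, so only the double integral matters.
    Write [c = M^(1/eta) N^(1/theta)] and let [rgamma_seq n v = (v)_n / ((n-1)! n^v)], which tends
    to [1/Gamma(v)].  Up to a scalar independent of [z] and [s], which cancels in
    [F_c(s,z)/F_c(t,w)], the function [F_c(s,z) c^(-z)] is a fixed rational function of [z] times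
    [rgamma_seq N (U + z/theta) / rgamma_seq M (V - z/eta)].  The ratio of consecutive
    [rgamma_seq n v] is [1 + O(n^-2)], which gives uniform convergence on compact sets; the
    recurrence [rgamma_seq n (v+1) = rgamma_seq n v (1/v + 1/n)] gives, uniformly in [n], decay
    along the contour faster than any exponential.  Hence the convergence holds in every
    exponentially weighted sup norm on the contour, for which the double integral is a bounded
    bilinear form.  The inner contour is the reflection of the outer one, and
    [1/F_c(alpha,eta,theta,M,N,t)(-w) = F_c(alpha,theta,eta,N,M,-t)(w)], so both factors are
    treated alike. *)

(** * Complex continuity and the exponential *)

(** Up to polynomial factors, [rgamma_seq n v] with n fixed decays to the right only like n^(-Re v),
    so no single index has every exponential rate. The contraction factor 1/v + 1/n shows that a
    rate K is reached once n passes a threshold depending on K, which is why convergence is stated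
    rate by rate. All rates are wanted because x and y are arbitrary, so x^z may grow at any
    exponential rate along the rays. After reflection the kernel 1/(z - w) becomes 1/(z + w) with
    both variables in Re >= d, hence bounded. The integrand is then a function of z times a function
    of w times a bounded kernel, and M and N sit in separate factors, which yields the independent
    limits. The upper bound on d keeps the vertical side of the contour left of the first pole of
    Gamma(V - z/eta); the rays pass the poles at height d. Limits and improper integrals are chosen
    by [epsilon], so an identity between them makes sense only after convergence is known.
    Integrability is therefore carried through every algebraic step. *)

Lemma filterlim_Cmod {T : Type} (F : (T -> Prop) -> Prop) {FF : Filter F}
  (f : T -> C) (l : C) :
  filterlim f F (locally l) <->
  (forall eps, 0 < eps -> F (fun t => Cmod (f t - l)%C < eps)).
Proof.
  split.
  - intros H eps He.
    assert (Hs : 0 < sqrt 2) by (apply sqrt_lt_R0; lra).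
    assert (He' : 0 < eps / sqrt 2) by (apply Rdiv_lt_0_compat; lra).
    generalize (proj1 (filterlim_locally f l) H (mkposreal _ He')).
    apply filter_imp; intros t Ht.
    apply C_NormedModule_mixin_compat2 in Ht; simpl in Ht.
    replace (sqrt 2 * (eps / sqrt 2)) with eps in Ht by (field; lra).
    exact Ht.
  - intros H. apply filterlim_locally; intros eps.
    generalize (H eps (cond_pos eps)).
    apply filter_imp; intros t Ht.
    apply C_NormedModule_mixin_compat1. exact Ht.
Qed.

Lemma Clim_seq_correct (u : nat -> C) (l : C) :
  filterlim u eventually (locally l) -> Clim_seq u = l.
Proof.
  intros H. apply (@filterlim_locally_unique nat C_AbsRing C_NormedModule eventually _ u); auto.
  unfold Clim_seq. apply epsilon_spec. now exists l.
Qed.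

Lemma Cmod_minus_comm (a b : C) : Cmod (a - b)%C = Cmod (b - a)%C.
Proof. rewrite <- Cmod_opp. f_equal. ring. Qed.

Lemma Cmod_triangle_minus (a b : C) : Cmod (a - b)%C <= Cmod a + Cmod b.
Proof. unfold Cminus. rewrite <- (Cmod_opp b). apply Cmod_triangle. Qed.

Lemma Cmod_reverse_triangle (a b : C) : Cmod a - Cmod b <= Cmod (a + b)%C.
Proof.
  assert (H := Cmod_triangle_minus (a + b)%C b).
  replace (a + b - b)%C with a in H by ring. lra.
Qed.

Lemma Cmod_le_parts (z : C) : Cmod z <= Rabs (Re z) + Rabs (Im z).
Proof.
  destruct z as [x y].
  replace (x, y) with (RtoC x + Ci * RtoC y)%C at 1
    by (apply injective_projections; simpl; ring).
  eapply Rle_trans; [apply Cmod_triangle|].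
  rewrite Cmod_mult, Cmod_Ci, !Cmod_R. simpl. lra.
Qed.

Lemma im_le_Cmod (z : C) : Rabs (Im z) <= Cmod z.
Proof. eapply Rle_trans; [|apply Rmax_Cmod]. apply Rmax_r. Qed.

(** Stated with [Cmod] instead of filters: the balls of [C] as a uniform space are squares, and the
    estimates below all use the modulus. *)
Definition Ccont (f : C -> C) (z : C) : Prop :=
  forall eps, 0 < eps -> exists delta, 0 < delta /\
    forall z', Cmod (z' - z)%C < delta -> Cmod (f z' - f z)%C < eps.

Lemma Ccont_const (c z : C) : Ccont (fun _ => c) z.
Proof.
  intros eps He. exists 1. split; [lra|]. intros.
  replace (c - c)%C with (RtoC 0) by ring. now rewrite Cmod_0.
Qed.

Lemma Ccont_id (z : C) : Ccont (fun z => z) z.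
Proof. intros eps He. exists eps. auto. Qed.

Lemma Ccont_plus (f g : C -> C) (z : C) :
  Ccont f z -> Ccont g z -> Ccont (fun z => f z + g z)%C z.
Proof.
  intros Hf Hg eps He.
  destruct (Hf (eps / 2)) as [d1 [Hd1 H1]]; [lra|].
  destruct (Hg (eps / 2)) as [d2 [Hd2 H2]]; [lra|].
  exists (Rmin d1 d2). split; [now apply Rmin_pos|]. intros z' Hz'.
  assert (A1 := H1 z' (Rlt_le_trans _ _ _ Hz' (Rmin_l _ _))).
  assert (A2 := H2 z' (Rlt_le_trans _ _ _ Hz' (Rmin_r _ _))).
  replace (f z' + g z' - (f z + g z))%C with ((f z' - f z) + (g z' - g z))%C by ring.
  eapply Rle_lt_trans; [apply Cmod_triangle|lra].
Qed.

Lemma Ccont_mult (f g : C -> C) (z : C) :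
  Ccont f z -> Ccont g z -> Ccont (fun z => f z * g z)%C z.
Proof.
  intros Hf Hg eps He.
  assert (Pf := Cmod_ge_0 (f z)). assert (Pg := Cmod_ge_0 (g z)).
  set (K := 1 + Cmod (f z) + Cmod (g z)).
  assert (HK : 0 < K) by (unfold K; lra).
  destruct (Hf (eps / (2 * K))) as [d1 [Hd1 H1]]; [apply Rdiv_lt_0_compat; lra|].
  destruct (Hg (Rmin 1 (eps / (2 * K)))) as [d2 [Hd2 H2]];
    [apply Rmin_pos; [lra|apply Rdiv_lt_0_compat; lra]|].
  exists (Rmin d1 d2). split; [now apply Rmin_pos|]. intros z' Hz'.
  assert (A1 := H1 z' (Rlt_le_trans _ _ _ Hz' (Rmin_l _ _))).
  assert (A2 := H2 z' (Rlt_le_trans _ _ _ Hz' (Rmin_r _ _))).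
  assert (A3 := Rlt_le_trans _ _ _ A2 (Rmin_l _ _)).
  assert (A4 := Rlt_le_trans _ _ _ A2 (Rmin_r _ _)).
  assert (A5 : Cmod (g z') <= K).
  { replace (g z') with ((g z' - g z) + g z)%C by ring.
    eapply Rle_trans; [apply Cmod_triangle|unfold K; lra]. }
  replace (f z' * g z' - f z * g z)%C
    with ((f z' - f z) * g z' + f z * (g z' - g z))%C by ring.
  eapply Rle_lt_trans; [apply Cmod_triangle|]. rewrite !Cmod_mult.
  assert (E : eps / (2 * K) * K = eps / 2) by (field; lra).
  assert (Cmod (f z' - f z) * Cmod (g z') <= eps / (2 * K) * K)
    by (apply Rmult_le_compat; try apply Cmod_ge_0; lra).
  assert (Cmod (f z) * Cmod (g z' - g z) <= Cmod (f z) * (eps / (2 * K)))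
    by (apply Rmult_le_compat_l; lra).
  assert (0 < eps / (2 * K)) by (apply Rdiv_lt_0_compat; lra).
  assert (Cmod (f z) * (eps / (2 * K)) < K * (eps / (2 * K)))
    by (apply Rmult_lt_compat_r; [assumption|unfold K; lra]).
  lra.
Qed.

Lemma Ccont_opp (f : C -> C) (z : C) : Ccont f z -> Ccont (fun z => - f z)%C z.
Proof.
  intros Hf eps He. destruct (Hf eps He) as [dl [Hd H]].
  exists dl. split; auto. intros z' Hz'.
  replace (- f z' - - f z)%C with (- (f z' - f z))%C by ring.
  rewrite Cmod_opp. auto.
Qed.

Lemma Ccont_minus (f g : C -> C) (z : C) :
  Ccont f z -> Ccont g z -> Ccont (fun z => f z - g z)%C z.
Proof. intros Hf Hg. apply (Ccont_plus f (fun z => - g z)%C); auto. now apply Ccont_opp. Qed.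

Lemma Ccont_inv (f : C -> C) (z : C) :
  f z <> RtoC 0 -> Ccont f z -> Ccont (fun z => / f z)%C z.
Proof.
  intros Hz Hf eps He.
  assert (P := proj1 (Cmod_gt_0 _) Hz). set (m := Cmod (f z)) in *.
  assert (Hm : 0 < eps * (m * m) / 2) by (assert (0 < m * m) by nra; nra).
  destruct (Hf (Rmin (m / 2) (eps * (m * m) / 2))) as [dl [Hd H]]; [apply Rmin_pos; lra|].
  exists dl. split; auto. intros z' Hz'.
  assert (A := H z' Hz').
  assert (A1 := Rlt_le_trans _ _ _ A (Rmin_l _ _)).
  assert (A2 := Rlt_le_trans _ _ _ A (Rmin_r _ _)).
  assert (A3 : m / 2 <= Cmod (f z')).
  { assert (T := Cmod_reverse_triangle (f z) (f z' - f z)%C).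
    replace (f z + (f z' - f z))%C with (f z') in T by ring. fold m in T. lra. }
  assert (Hz2 : f z' <> RtoC 0) by (apply Cmod_gt_0; lra).
  replace (/ f z' - / f z)%C with ((f z - f z') / (f z' * f z))%C by (field; auto).
  rewrite Cmod_div, Cmod_mult by (now apply Cmult_neq_0).
  rewrite Cmod_minus_comm. fold m.
  apply (Rmult_lt_reg_r (Cmod (f z') * m)); [nra|].
  unfold Rdiv. rewrite Rmult_assoc, Rinv_l by nra.
  assert (m / 2 * m <= Cmod (f z') * m) by (apply Rmult_le_compat_r; lra).
  assert (eps * (m / 2 * m) <= eps * (Cmod (f z') * m)) by (apply Rmult_le_compat_l; lra).
  lra.
Qed.

Lemma Ccont_comp (f g : C -> C) (z : C) :
  Ccont f z -> Ccont g (f z) -> Ccont (fun z => g (f z)) z.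
Proof.
  intros Hf Hg eps He. destruct (Hg eps He) as [d1 [Hd1 H1]].
  destruct (Hf d1 Hd1) as [d2 [Hd2 H2]]. exists d2. auto.
Qed.

(** * The complex exponential and its first-order Taylor bound *)

Lemma cexp_plus (a b : C) : cexp (a + b)%C = (cexp a * cexp b)%C.
Proof.
  unfold cexp. destruct a as [a1 a2], b as [b1 b2]; simpl.
  rewrite exp_plus, cos_plus, sin_plus.
  apply injective_projections; simpl; ring.
Qed.

Lemma cexp_0 : cexp (RtoC 0) = RtoC 1.
Proof.
  unfold cexp; simpl. rewrite exp_0, cos_0, sin_0.
  apply injective_projections; simpl; ring.
Qed.

Lemma cexp_RtoC (x : R) : cexp (RtoC x) = RtoC (exp x).
Proof.
  unfold cexp; simpl. rewrite cos_0, sin_0.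
  apply injective_projections; simpl; ring.
Qed.

Lemma Cmod_cexp (z : C) : Cmod (cexp z) = exp (Re z).
Proof.
  unfold cexp, Cmod; simpl.
  replace (_ + _) with (exp (Re z) * exp (Re z) * (Rsqr (sin (Im z)) + Rsqr (cos (Im z))))
    by (unfold Rsqr; ring).
  rewrite sin2_cos2, Rmult_1_r. apply sqrt_square. left; apply exp_pos.
Qed.

Lemma cexp_neq_0 (z : C) : cexp z <> RtoC 0.
Proof. apply Cmod_gt_0. rewrite Cmod_cexp. apply exp_pos. Qed.

Lemma cexp_opp (z : C) : cexp (- z)%C = (/ cexp z)%C.
Proof.
  assert (H : (cexp (- z) * cexp z)%C = RtoC 1).
  { rewrite <- cexp_plus. replace (- z + z)%C with (RtoC 0) by ring. apply cexp_0. }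
  assert (N := cexp_neq_0 z).
  replace (cexp (- z)) with (cexp (- z) * cexp z * / cexp z)%C by (field; auto).
  rewrite H. ring.
Qed.

(** Both signs follow from 1 + x <= exp x taken at x and at -x; the latter, multiplied by exp x,
    gives exp x - 1 <= x exp x. *)
Lemma exp_minus_1_bound (x : R) : Rabs (exp x - 1) <= Rabs x * exp (Rabs x).
Proof.
  assert (A := exp_ineq1_le x). assert (B := exp_ineq1_le (- x)).
  assert (E : exp x * exp (- x) = 1) by (rewrite <- exp_plus, Rplus_opp_r; apply exp_0).
  assert (P := exp_pos x).
  assert (exp x - 1 <= x * exp x) by nra.
  unfold Rabs. destruct (Rcase_abs x); destruct (Rcase_abs (exp x - 1)); nra.
Qed.

Lemma exp_taylor1_bound (x : R) : Rabs (exp x - 1 - x) <= x * x * exp (Rabs x).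
Proof.
  assert (A := exp_ineq1_le x). assert (B := exp_ineq1_le (- x)).
  assert (E : exp x * exp (- x) = 1) by (rewrite <- exp_plus, Rplus_opp_r; apply exp_0).
  assert (P := exp_pos x).
  assert (D : exp x - 1 <= x * exp x) by nra.
  rewrite Rabs_right by lra.
  assert (S : exp x - 1 - x <= x * (exp x - 1)) by lra.
  assert (G := exp_ineq1_le (Rabs x)). assert (Rabs x >= 0) by (apply Rle_ge, Rabs_pos).
  unfold Rabs in *. destruct (Rcase_abs x); nra.
Qed.

Lemma Rabs_sin_le (y : R) : Rabs (sin y) <= Rabs y.
Proof.
  destruct (MVT_gen sin 0 y cos) as [c [_ H]].
  - intros. apply is_derive_sin.
  - intros. apply continuity_sin.
  - rewrite sin_0 in H. replace (sin y) with (cos c * y) by lra.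
    rewrite Rabs_mult. assert (B := COS_bound c).
    assert (Rabs (cos c) <= 1) by (apply Rabs_le; lra).
    assert (P := Rabs_pos y). nra.
Qed.

Lemma one_minus_cos_bound (y : R) : Rabs (1 - cos y) <= Rabs y /\ Rabs (1 - cos y) <= y * y.
Proof.
  assert (E : 1 - cos y = 2 * sin (y / 2) * sin (y / 2)).
  { replace y with (2 * (y / 2)) at 1 by field. rewrite cos_2a_sin. ring. }
  assert (A := Rabs_sin_le (y / 2)). assert (B := SIN_bound (y / 2)).
  replace (Rabs (y / 2)) with (Rabs y / 2) in A
    by (unfold Rdiv; rewrite Rabs_mult, (Rabs_right (/ 2)); lra).
  rewrite E, !Rabs_mult, (Rabs_right 2) by lra.
  assert (C1 : Rabs (sin (y / 2)) <= 1) by (apply Rabs_le; lra).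
  assert (P := Rabs_pos (sin (y / 2))). assert (Q := Rabs_pos y).
  assert (Y : y * y = Rabs y * Rabs y) by (rewrite <- Rabs_mult; symmetry; apply Rabs_right; nra).
  split; [nra|rewrite Y; nra].
Qed.

Lemma sin_taylor1_bound (y : R) : Rabs (sin y - y) <= y * y.
Proof.
  destruct (MVT_gen (fun y => sin y - y) 0 y (fun y => cos y - 1)) as [c [Hc H]].
  - intros. auto_derive; auto. ring.
  - intros. apply continuity_pt_minus; [apply continuity_sin|apply continuity_pt_id].
  - rewrite sin_0, !Rminus_0_r in H. rewrite H, Rabs_mult, Rabs_minus_sym.
    assert (B := proj1 (one_minus_cos_bound c)).
    assert (Rabs c <= Rabs y).
    { unfold Rmin, Rmax in Hc. destruct (Rle_dec 0 y).
      - rewrite !Rabs_right; lra.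
      - rewrite !Rabs_left1; lra. }
    assert (Y : y * y = Rabs y * Rabs y) by (rewrite <- Rabs_mult; symmetry; apply Rabs_right; nra).
    rewrite Y. apply Rmult_le_compat_r; [apply Rabs_pos|lra].
Qed.

Lemma cexp_taylor1_bound (z : C) :
  Cmod (cexp z - 1 - z)%C <= 4 * (Cmod z * Cmod z) * exp (Cmod z).
Proof.
  destruct z as [x y]. set (r := Cmod (x, y)).
  assert (Hx : Rabs x <= r) by apply (re_le_Cmod (x, y)).
  assert (Hy : Rabs y <= r) by apply (im_le_Cmod (x, y)).
  assert (Px := Rabs_pos x). assert (Py := Rabs_pos y).
  assert (X2 : x * x = Rabs x * Rabs x) by (rewrite <- Rabs_mult; symmetry; apply Rabs_right; nra).
  assert (Y2 : y * y = Rabs y * Rabs y) by (rewrite <- Rabs_mult; symmetry; apply Rabs_right; nra).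
  assert (R2 : r * r = x * x + y * y).
  { unfold r, Cmod. rewrite sqrt_sqrt; simpl; nra. }
  assert (Ee : exp (Rabs x) <= exp r).
  { destruct Hx as [Hx|Hx]; [left; now apply exp_increasing|rewrite Hx; lra]. }
  assert (Ex : exp x <= exp r).
  { assert (x <= r) by (eapply Rle_trans; [apply Rle_abs|exact Hx]).
    destruct H as [H|H]; [left; now apply exp_increasing|rewrite H; lra]. }
  assert (P := exp_pos x). assert (Pr := exp_pos r).
  (* Expanding the real exponential and the trigonometric functions separately leaves one cross term
     (exp x - 1) y. Each of the four pieces is at most a quadratic form in x and y times exp r; the
     constant 4 covers their sum. *)
  replace (cexp (x, y) - 1 - (x, y))%C with
    (RtoC (exp x - 1 - x) + (RtoC (exp x * (cos y - 1)) + Ci * RtoC (exp x * (sin y - y)))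
      + Ci * RtoC ((exp x - 1) * y))%C
    by (apply injective_projections; unfold cexp; simpl; ring).
  assert (T1 : Cmod (RtoC (exp x - 1 - x)) <= x * x * exp r).
  { rewrite Cmod_R. eapply Rle_trans; [apply exp_taylor1_bound|].
    apply Rmult_le_compat_l; nra. }
  assert (T2 : Cmod (RtoC (exp x * (cos y - 1)))%C <= exp r * (y * y)).
  { rewrite Cmod_R, Rabs_mult, Rabs_right by lra. rewrite Rabs_minus_sym.
    apply Rmult_le_compat; try lra; [apply Rabs_pos|apply one_minus_cos_bound]. }
  assert (T3 : Cmod (Ci * RtoC (exp x * (sin y - y)))%C <= exp r * (y * y)).
  { rewrite Cmod_mult, Cmod_Ci, Cmod_R, Rabs_mult, Rabs_right by lra. rewrite Rmult_1_l.
    apply Rmult_le_compat; try lra; [apply Rabs_pos|apply sin_taylor1_bound]. }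
  assert (T4 : Cmod (Ci * RtoC ((exp x - 1) * y))%C <= Rabs x * exp r * Rabs y).
  { rewrite Cmod_mult, Cmod_Ci, Cmod_R, Rabs_mult, Rmult_1_l.
    apply Rmult_le_compat_r; [lra|].
    eapply Rle_trans; [apply exp_minus_1_bound|]. apply Rmult_le_compat_l; lra. }
  eapply Rle_trans; [apply Cmod_triangle|].
  eapply Rle_trans; [apply Rplus_le_compat_r, Cmod_triangle|].
  eapply Rle_trans; [apply Rplus_le_compat_r, Rplus_le_compat_l, Cmod_triangle|].
  rewrite R2.
  assert (Rabs x * Rabs y <= x * x + y * y) by nra.
  assert (Rabs x * exp r * Rabs y <= (x * x + y * y) * exp r).
  { replace (Rabs x * exp r * Rabs y) with (Rabs x * Rabs y * exp r) by ring.
    apply Rmult_le_compat_r; lra. }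
  nra.
Qed.

Lemma Ccont_cexp (z : C) : Ccont cexp z.
Proof.
  intros eps He.
  set (K := (1 + 4 * exp 1) * exp (Re z)).
  assert (P1 := exp_pos 1). assert (P2 := exp_pos (Re z)).
  assert (HK : 0 < K) by (unfold K; nra).
  exists (Rmin 1 (eps / K)). split; [apply Rmin_pos; [lra|now apply Rdiv_lt_0_compat]|].
  intros z' Hz'. set (w := (z' - z)%C) in *.
  assert (A1 := Rlt_le_trans _ _ _ Hz' (Rmin_l _ _)).
  assert (A2 := Rlt_le_trans _ _ _ Hz' (Rmin_r _ _)).
  replace (cexp z' - cexp z)%C with (cexp z * ((cexp w - 1 - w) + w))%C.
  2:{ replace z' with (z + w)%C by (unfold w; ring). rewrite cexp_plus. ring. }
  rewrite Cmod_mult, Cmod_cexp.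
  assert (B := cexp_taylor1_bound w). assert (P := Cmod_ge_0 w).
  assert (Cmod (cexp w - 1 - w + w)%C <= (1 + 4 * exp 1) * Cmod w).
  { eapply Rle_trans; [apply Cmod_triangle|].
    assert (exp (Cmod w) <= exp 1) by (left; now apply exp_increasing).
    assert (4 * (Cmod w * Cmod w) * exp (Cmod w) <= 4 * Cmod w * exp 1).
    { apply Rmult_le_compat; try nra. left; apply exp_pos. }
    lra. }
  apply Rle_lt_trans with (K * Cmod w).
  - unfold K. replace ((1 + 4 * exp 1) * exp (Re z) * Cmod w)
      with (exp (Re z) * ((1 + 4 * exp 1) * Cmod w)) by ring.
    apply Rmult_le_compat_l; lra.
  - apply (Rmult_lt_compat_l K) in A2; auto.
    replace (K * (eps / K)) with eps in A2 by (field; lra). exact A2.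
Qed.

(** * The reciprocal Gamma function *)

(** Gauss's approximant of 1/Gamma with n factors in place of n + 1, hence [pred n]. This matches
    the length of the Pochhammer symbols in [F_c] and makes the term of index 1 equal to v, where
    the inductions start. *)
Definition rgamma_seq (n : nat) (v : C) : C :=
  (pochn v n * cexp (- (v * RtoC (ln (INR n)))) / RtoC (INR (fact (pred n))))%C.

(** The reciprocal is preferred to [CGamma] because the sequence converges at every v, the poles of
    Gamma included. *)
Definition rgamma (v : C) : C := Clim_seq (fun n => rgamma_seq n v).

Definition rgamma_ratio (n : nat) (v : C) : C :=
  ((1 + v / RtoC (INR n)) * cexp (- (v * RtoC (ln (1 + / INR n)))))%C.

Lemma INR_ge_1 (n : nat) : (1 <= n)%nat -> 1 <= INR n.
Proof. intros H. apply (le_INR 1 n) in H. exact H. Qed.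

Lemma RtoC_neq_0 (x : R) : x <> 0 -> RtoC x <> RtoC 0.
Proof. intros H E. apply H. now injection E. Qed.

Lemma Cmod_RtoC_pos (x : R) : 0 <= x -> Cmod (RtoC x) = x.
Proof. intros. rewrite Cmod_R. apply Rabs_right; lra. Qed.

Lemma INR_fact_neq_0C (n : nat) : RtoC (INR (fact n)) <> RtoC 0.
Proof. apply RtoC_neq_0, INR_fact_neq_0. Qed.

Lemma INR_fact_pred (n : nat) : (1 <= n)%nat ->
  RtoC (INR (fact n)) = (RtoC (INR n) * RtoC (INR (fact (pred n))))%C.
Proof.
  intros Hn. rewrite <- RtoC_mult, <- mult_INR. do 2 f_equal. destruct n; [lia|reflexivity].
Qed.

Lemma rgamma_seq_1 (v : C) : rgamma_seq 1 v = v.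
Proof.
  unfold rgamma_seq; simpl. rewrite ln_1.
  replace (- (v * 0))%C with (RtoC 0) by ring. rewrite cexp_0.
  field.
Qed.

Lemma rgamma_seq_S (n : nat) (v : C) : (1 <= n)%nat ->
  rgamma_seq (S n) v = (rgamma_seq n v * rgamma_ratio n v)%C.
Proof.
  intros Hn. assert (H1 := INR_ge_1 n Hn).
  unfold rgamma_seq, rgamma_ratio. simpl pochn. simpl pred.
  assert (El : ln (INR (S n)) = ln (INR n) + ln (1 + / INR n)).
  { rewrite <- ln_mult; [|lra|assert (0 < / INR n) by (apply Rinv_0_lt_compat; lra); lra].
    f_equal. rewrite S_INR. field. lra. }
  rewrite El, RtoC_plus.
  replace (- (v * (RtoC (ln (INR n)) + RtoC (ln (1 + / INR n)))))%C
    with (- (v * RtoC (ln (INR n))) + - (v * RtoC (ln (1 + / INR n))))%C by ring.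
  rewrite cexp_plus.
  rewrite (INR_fact_pred n Hn). field. split; [apply RtoC_neq_0; lra|apply INR_fact_neq_0C].
Qed.

(** Both bounds are ln y <= y - 1, at y = 1 + x and at y = 1/(1 + x). *)
Lemma ln_1_plus_bounds (x : R) : 0 < x -> x - x * x <= ln (1 + x) <= x.
Proof.
  intros Hx.
  assert (L : forall y, 0 < y -> ln y <= y - 1).
  { intros y Hy. rewrite <- (ln_exp (y - 1)). apply ln_le; auto.
    assert (A := exp_ineq1_le (y - 1)). lra. }
  split.
  - assert (A := L (/ (1 + x)) ltac:(apply Rinv_0_lt_compat; lra)).
    rewrite ln_Rinv in A by lra.
    assert (/ (1 + x) <= 1 - x + x * x).
    { apply (Rmult_le_reg_l (1 + x)); [lra|]. rewrite Rinv_r by lra. nra. }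
    lra.
  - assert (A := L (1 + x) ltac:(lra)). lra.
Qed.

Lemma rgamma_ratio_bound (r : R) : 0 <= r -> exists c, 0 <= c /\
  forall n v, (1 <= n)%nat -> Cmod v <= r ->
    Cmod (rgamma_ratio n v - 1)%C <= c / (INR n * INR n).
Proof.
  intros Hr. assert (Pe := exp_pos r).
  exists (r + r * r + (1 + r) * (4 * (r * r) * exp r)).
  assert (0 <= r * r) by nra.
  assert (0 <= (1 + r) * (4 * (r * r) * exp r)) by (repeat apply Rmult_le_pos; lra).
  split; [lra|].
  intros n v Hn Hv. assert (H1 := INR_ge_1 n Hn). unfold rgamma_ratio.
  set (x := / INR n).
  assert (Hx : 0 < x) by (apply Rinv_0_lt_compat; lra).
  assert (Hx1 : x <= 1) by (unfold x; rewrite <- Rinv_1; apply Rinv_le_contravar; lra).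
  replace (v / RtoC (INR n))%C with (v * RtoC x)%C
    by (unfold x; rewrite RtoC_inv by lra; reflexivity).
  destruct (ln_1_plus_bounds x Hx) as [L1 L2].
  set (l := ln (1 + x)) in *.
  assert (Hl : 0 <= l).
  { unfold l. rewrite <- ln_1. destruct (Req_dec (1) (1 + x)) as [E|E]; [rewrite E at 1; lra|].
    left. apply ln_increasing; lra. }
  set (z := (- (v * RtoC l))%C).
  assert (Hz : Cmod z <= r * x).
  { unfold z. rewrite Cmod_opp, Cmod_mult, Cmod_RtoC_pos by lra.
    apply Rmult_le_compat; try lra. apply Cmod_ge_0. }
  assert (Pz := Cmod_ge_0 z). assert (Pv := Cmod_ge_0 v).
  assert (Hzr : Cmod z <= r) by nra.
  assert (B := cexp_taylor1_bound z).
  assert (B' : Cmod (cexp z - 1 - z)%C <= 4 * (r * r) * exp r * (x * x)).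
  { eapply Rle_trans; [exact B|].
    assert (exp (Cmod z) <= exp r)
      by (destruct Hzr as [A|A]; [left; now apply exp_increasing|rewrite A; lra]).
    assert (Cmod z * Cmod z <= (r * x) * (r * x)) by (apply Rmult_le_compat; lra).
    replace (4 * (r * r) * exp r * (x * x)) with (4 * ((r * x) * (r * x)) * exp r) by ring.
    apply Rmult_le_compat; try nra. left; apply exp_pos. }
  (* The first-order terms v x and z = - v l cancel up to v (x - l), which is quadratic in x by the
     bounds on the logarithm; the other terms are quadratic already. *)
  replace ((1 + v * RtoC x) * cexp z - 1)%C with
    (v * RtoC (x - l) + (v * RtoC x * z + (1 + v * RtoC x) * (cexp z - 1 - z)))%C
    by (unfold z; rewrite RtoC_minus; ring).
  assert (T1 : Cmod (v * RtoC (x - l))%C <= r * (x * x)).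
  { rewrite Cmod_mult, Cmod_RtoC_pos by lra. apply Rmult_le_compat; lra. }
  assert (Hvx : Cmod (v * RtoC x)%C <= r * x).
  { rewrite Cmod_mult, Cmod_RtoC_pos by lra. apply Rmult_le_compat; lra. }
  assert (T2 : Cmod (v * RtoC x * z)%C <= r * r * (x * x)).
  { rewrite (Cmod_mult (v * RtoC x)).
    replace (r * r * (x * x)) with ((r * x) * (r * x)) by ring.
    apply Rmult_le_compat; try lra. apply Cmod_ge_0. }
  assert (T3 : Cmod ((1 + v * RtoC x) * (cexp z - 1 - z))%C
      <= (1 + r) * (4 * (r * r) * exp r * (x * x))).
  { rewrite Cmod_mult. apply Rmult_le_compat; try apply Cmod_ge_0; [|exact B'].
    eapply Rle_trans; [apply Cmod_triangle|]. rewrite Cmod_1. nra. }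
  replace (_ / (INR n * INR n))
    with (r * (x * x) + (r * r * (x * x) + (1 + r) * (4 * (r * r) * exp r * (x * x))))
    by (unfold x; field; lra).
  eapply Rle_trans; [apply Cmod_triangle|].
  eapply Rle_trans; [apply Rplus_le_compat_l, Cmod_triangle|]. lra.
Qed.

(** Replaces the summable c/n^2 by a telescoping difference, so that infinite products can be
    controlled by induction with an explicit remainder instead of by series. *)
Lemma inv_sq_telescope (c n : R) : 0 <= c -> 1 <= n ->
  c / (n * n) <= 2 * c / n - 2 * c / (n + 1).
Proof.
  intros Hc Hn.
  replace (2 * c / n - 2 * c / (n + 1)) with (c / (n * n) * (2 * n / (n + 1))) by (field; lra).
  assert (0 <= c / (n * n)) by (apply Rmult_le_pos; [lra|left; apply Rinv_0_lt_compat; nra]).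
  assert (1 <= 2 * n / (n + 1)).
  { apply (Rmult_le_reg_r (n + 1)); [lra|]. unfold Rdiv. rewrite Rmult_assoc, Rinv_l; lra. }
  nra.
Qed.

Lemma rgamma_seq_bounded (r : R) : 0 <= r -> exists B, 0 <= B /\
  forall n v, (1 <= n)%nat -> Cmod v <= r -> Cmod (rgamma_seq n v) <= B.
Proof.
  intros Hr. destruct (rgamma_ratio_bound r Hr) as [c [Hc H]].
  exists (r * exp (2 * c)). split; [apply Rmult_le_pos; [lra|left; apply exp_pos]|].
  (* The remainder - 2c/n is the telescoped sum of the ratio errors up to n; it vanishes together
     with 2c at n = 1, and it makes the induction close. *)
  assert (A : forall n v, (1 <= n)%nat -> Cmod v <= r ->
    Cmod (rgamma_seq n v) <= r * exp (2 * c - 2 * c / INR n)).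
  { intros n v Hn Hv. induction Hn as [|n Hn IH].
    - rewrite rgamma_seq_1. simpl INR. replace (2 * c - 2 * c / 1) with 0 by field.
      rewrite exp_0. lra.
    - assert (H1 := INR_ge_1 n Hn).
      rewrite rgamma_seq_S, Cmod_mult by auto. rewrite S_INR.
      assert (Q : Cmod (rgamma_ratio n v) <= exp (2 * c / INR n - 2 * c / (INR n + 1))).
      { replace (rgamma_ratio n v) with ((rgamma_ratio n v - 1) + 1)%C by ring.
        eapply Rle_trans; [apply Cmod_triangle|]. rewrite Cmod_1.
        assert (T := inv_sq_telescope c (INR n) Hc H1).
        assert (H' := H n v Hn Hv).
        assert (X := exp_ineq1_le (2 * c / INR n - 2 * c / (INR n + 1))). lra. }
      replace (2 * c - 2 * c / (INR n + 1))
        with ((2 * c - 2 * c / INR n) + (2 * c / INR n - 2 * c / (INR n + 1))) by ring.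
      rewrite exp_plus, <- Rmult_assoc.
      apply Rmult_le_compat; auto; apply Cmod_ge_0. }
  intros n v Hn Hv. eapply Rle_trans; [now apply A|].
  apply Rmult_le_compat_l; auto. assert (H1 := INR_ge_1 n Hn).
  assert (0 <= 2 * c / INR n) by (apply Rmult_le_pos; [lra|left; apply Rinv_0_lt_compat; lra]).
  destruct (Req_dec (2 * c - 2 * c / INR n) (2 * c)) as [E|E]; [rewrite E; lra|].
  left; apply exp_increasing; lra.
Qed.

Lemma rgamma_seq_cauchy (r : R) : 0 <= r -> exists D, 0 <= D /\
  forall n k v, (1 <= n)%nat -> Cmod v <= r ->
    Cmod (rgamma_seq (n + k) v - rgamma_seq n v)%C <= D / INR n.
Proof.
  intros Hr. destruct (rgamma_ratio_bound r Hr) as [c [Hc H]].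
  destruct (rgamma_seq_bounded r Hr) as [B [HB HB']].
  assert (HBc : 0 <= B * c) by (now apply Rmult_le_pos).
  exists (2 * (B * c)). split; [lra|].
  intros n k v Hn Hv.
  assert (A : Cmod (rgamma_seq (n + k) v - rgamma_seq n v)%C
      <= 2 * (B * c) / INR n - 2 * (B * c) / INR (n + k)).
  { induction k as [|k IH].
    - rewrite Nat.add_0_r. replace (_ - _)%C with (RtoC 0) by ring. rewrite Cmod_0. lra.
    - rewrite Nat.add_succ_r, rgamma_seq_S, S_INR by lia.
      assert (H1 := INR_ge_1 (n + k) ltac:(lia)).
      set (a := rgamma_seq (n + k) v) in *. set (q := rgamma_ratio (n + k) v).
      replace (a * q - rgamma_seq n v)%C with ((a - rgamma_seq n v) + a * (q - 1))%C by ring.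
      eapply Rle_trans; [apply Cmod_triangle|]. rewrite Cmod_mult.
      assert (T := inv_sq_telescope (B * c) (INR (n + k)) HBc H1).
      assert (Cmod a * Cmod (q - 1)%C <= B * (c / (INR (n + k) * INR (n + k)))).
      { apply Rmult_le_compat; try apply Cmod_ge_0; [apply HB'|apply H]; auto; lia. }
      unfold Rdiv in *. lra. }
  assert (H1 := INR_ge_1 (n + k) ltac:(lia)).
  assert (0 <= 2 * (B * c) / INR (n + k))
    by (apply Rmult_le_pos; [lra|left; apply Rinv_0_lt_compat; lra]).
  lra.
Qed.

Lemma INR_archimed_div (D eps : R) : 0 < eps ->
  exists n0, (1 <= n0)%nat /\ forall n, (n0 <= n)%nat -> D / INR n < eps.
Proof.
  intros He. destruct (INR_archimed eps (Rabs D) He) as [n0 Hn0].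
  exists (S n0). split; [lia|]. intros n Hn.
  assert (H1 := INR_ge_1 n ltac:(lia)).
  assert (INR n0 <= INR n) by (apply le_INR; lia).
  apply (Rmult_lt_reg_r (INR n)); [lra|].
  unfold Rdiv. rewrite Rmult_assoc, Rinv_l by lra.
  assert (D <= Rabs D) by apply Rle_abs. nra.
Qed.

Lemma rgamma_seq_cvg (v : C) :
  filterlim (fun n => rgamma_seq n v) eventually (locally (rgamma v)).
Proof.
  assert (E : exists l, filterlim (fun n => rgamma_seq n v) eventually (locally l)).
  { apply (@filterlim_locally_cauchy nat C_R_CompleteNormedModule).
    - typeclasses eauto.
    - intros eps. destruct (rgamma_seq_cauchy (Cmod v) (Cmod_ge_0 v)) as [D [HD H]].
      destruct (INR_archimed_div D eps (cond_pos eps)) as [n0 [Hn0 Hn0']].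
      exists (fun n => (n0 <= n)%nat). split; [now exists n0|].
      intros m n Hm Hn.
      assert (S : forall a b, (n0 <= a)%nat -> (a <= b)%nat ->
        Cmod (rgamma_seq b v - rgamma_seq a v)%C < eps).
      { intros a b Ha Hab. replace b with (a + (b - a))%nat by lia.
        eapply Rle_lt_trans; [apply H; [lia|lra]|]. apply Hn0'. lia. }
      apply C_NormedModule_mixin_compat1.
      change (Cmod (rgamma_seq n v - rgamma_seq m v)%C < eps).
      destruct (Nat.le_ge_cases m n); [now apply S|].
      rewrite Cmod_minus_comm. now apply S. }
  unfold rgamma, Clim_seq. apply epsilon_spec. exact E.
Qed.

(** Lets k tend to infinity in [rgamma_seq_cauchy]. The rate depends on the disc only, which is the
    uniform convergence on compact sets. *)
Lemma rgamma_seq_error (r : R) : 0 <= r -> exists D, 0 <= D /\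
  forall n v, (1 <= n)%nat -> Cmod v <= r ->
    Cmod (rgamma_seq n v - rgamma v)%C <= D / INR n.
Proof.
  intros Hr. destruct (rgamma_seq_cauchy r Hr) as [D [HD H]].
  exists D. split; auto. intros n v Hn Hv.
  apply le_epsilon. intros eps He.
  destruct (proj1 (filterlim_Cmod _ _ _) (rgamma_seq_cvg v) eps He) as [m Hm].
  assert (A := H n m v Hn Hv). assert (B := Hm (n + m)%nat ltac:(lia)).
  replace (rgamma_seq n v - rgamma v)%C
    with (- (rgamma_seq (n + m) v - rgamma_seq n v) + (rgamma_seq (n + m) v - rgamma v))%C by ring.
  eapply Rle_trans; [apply Cmod_triangle|]. rewrite Cmod_opp. lra.
Qed.

Lemma Ccont_pochn (n : nat) (v : C) : Ccont (fun v => pochn v n) v.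
Proof.
  induction n as [|n IH]; simpl; [apply Ccont_const|].
  apply (Ccont_mult (fun v => pochn v n)); auto.
  apply (Ccont_plus (fun v => v)); [apply Ccont_id|apply Ccont_const].
Qed.

Lemma Ccont_rgamma_seq (n : nat) (v : C) : Ccont (rgamma_seq n) v.
Proof.
  unfold rgamma_seq. apply Ccont_mult; [|apply Ccont_const].
  apply Ccont_mult; [apply Ccont_pochn|].
  apply (Ccont_comp (fun v => - (v * RtoC (ln (INR n))))%C); [|apply Ccont_cexp].
  apply Ccont_opp, Ccont_mult; [apply Ccont_id|apply Ccont_const].
Qed.

Lemma Ccont_rgamma (v : C) : Ccont rgamma v.
Proof.
  intros eps He. assert (Pv := Cmod_ge_0 v).
  destruct (rgamma_seq_error (Cmod v + 1)) as [D [HD H]]; [lra|].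
  destruct (INR_archimed_div D (eps / 3)) as [n [Hn Hn']]; [lra|].
  assert (Hn2 := Hn' n ltac:(lia)).
  destruct (Ccont_rgamma_seq n v (eps / 3)) as [dl [Hdl H']]; [lra|].
  exists (Rmin 1 dl). split; [apply Rmin_pos; lra|]. intros v' Hv'.
  assert (A1 := Rlt_le_trans _ _ _ Hv' (Rmin_l _ _)).
  assert (A2 := H' v' (Rlt_le_trans _ _ _ Hv' (Rmin_r _ _))).
  assert (A3 : Cmod v' <= Cmod v + 1).
  { replace v' with ((v' - v) + v)%C by ring.
    eapply Rle_trans; [apply Cmod_triangle|lra]. }
  assert (B1 := H n v' Hn A3). assert (B2 := H n v Hn ltac:(lra)).
  replace (rgamma v' - rgamma v)%C with
    (- (rgamma_seq n v' - rgamma v') + ((rgamma_seq n v' - rgamma_seq n v)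
      + (rgamma_seq n v - rgamma v)))%C by ring.
  eapply Rle_lt_trans; [apply Cmod_triangle|]. rewrite Cmod_opp.
  eapply Rle_lt_trans; [apply Rplus_le_compat_l, Cmod_triangle|]. lra.
Qed.

(** * Lower bounds at a positive distance from the poles of Gamma *)

Lemma Cmod_pochn_ge (v : C) (rho : R) (n : nat) : 0 <= rho ->
  (forall k, rho <= Cmod (v + RtoC (INR k))%C) -> rho ^ n <= Cmod (pochn v n).
Proof.
  intros Hr H. induction n as [|n IH]; simpl; [rewrite Cmod_1; lra|].
  rewrite Cmod_mult, Rmult_comm. apply Rmult_le_compat; auto. now apply pow_le.
Qed.

(** The product is cut at an index m with 2c/m < 1/2. The first m factors are bounded below through
    [rho], and the remaining ones cost at most a factor 1/2. This controls the reciprocals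
    1/[rgamma_seq], uniformly in n. *)
Lemma rgamma_seq_lower (r rho : R) : 0 <= r -> 0 < rho -> exists c n0, 0 < c /\ (1 <= n0)%nat /\
  forall n v, (n0 <= n)%nat -> Cmod v <= r ->
    (forall k, rho <= Cmod (v + RtoC (INR k))%C) -> c <= Cmod (rgamma_seq n v).
Proof.
  intros Hr Hrho. destruct (rgamma_ratio_bound r Hr) as [c [Hc H]].
  destruct (INR_archimed_div (2 * c) (1 / 2)) as [m [Hm Hm']]; [lra|].
  specialize (Hm' m ltac:(lia)).
  assert (Hm1 := INR_ge_1 m Hm).
  set (c0 := rho ^ m * exp (- (r * ln (INR m))) / INR (fact (pred m))).
  assert (Hc0 : 0 < c0).
  { unfold c0. apply Rdiv_lt_0_compat; [|apply INR_fact_lt_0].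
    apply Rmult_lt_0_compat; [now apply pow_lt|apply exp_pos]. }
  exists (c0 / 2), m. split; [lra|]. split; auto.
  assert (Base : forall v, Cmod v <= r -> (forall k, rho <= Cmod (v + RtoC (INR k))%C) ->
    c0 <= Cmod (rgamma_seq m v)).
  { intros v Hv Hk. unfold rgamma_seq, c0.
    rewrite Cmod_div, Cmod_mult, Cmod_cexp, Cmod_RtoC_pos; [|apply pos_INR|apply INR_fact_neq_0C].
    apply Rmult_le_compat_r; [left; apply Rinv_0_lt_compat, INR_fact_lt_0|].
    apply Rmult_le_compat; [apply pow_le; lra|left; apply exp_pos|apply Cmod_pochn_ge; auto; lra|].
    replace (Re (- (v * RtoC (ln (INR m))))%C) with (- (Re v * ln (INR m)))
      by (destruct v; simpl; ring).
    assert (Hl : 0 <= ln (INR m)).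
    { rewrite <- ln_1. destruct Hm1 as [A|A]; [left; apply ln_increasing; lra|rewrite <- A; lra]. }
    assert (Re v <= r) by (eapply Rle_trans; [apply Rle_abs|]; eapply Rle_trans; [apply re_le_Cmod|auto]).
    assert (A : - (r * ln (INR m)) <= - (Re v * ln (INR m))) by nra.
    destruct A as [A|A]; [left; now apply exp_increasing|rewrite A; lra]. }
  intros n v Hn Hv Hk.
  (* A product of factors 1 - y_i is at least 1 minus the sum of the y_i; the sum of the errors
     between m and n appears here in telescoped form. *)
  assert (A : Cmod (rgamma_seq m v) * (1 - 2 * c / INR m + 2 * c / INR n) <= Cmod (rgamma_seq n v)).
  { induction Hn as [|n Hn IH].
    - replace (1 - 2 * c / INR m + 2 * c / INR m) with 1 by ring. lra.
    - assert (H1 := INR_ge_1 n ltac:(lia)).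
      rewrite rgamma_seq_S, Cmod_mult, S_INR by lia.
      assert (Q : 1 - c / (INR n * INR n) <= Cmod (rgamma_ratio n v)).
      { assert (T := Cmod_reverse_triangle (RtoC 1) (rgamma_ratio n v - 1)%C).
        replace (1 + (rgamma_ratio n v - 1))%C with (rgamma_ratio n v) in T by ring.
        rewrite Cmod_1 in T. assert (H' := H n v ltac:(lia) Hv). lra. }
      assert (T := inv_sq_telescope c (INR n) Hc H1).
      set (y := c / (INR n * INR n)) in *.
      assert (Hy : 0 <= y) by (apply Rmult_le_pos; [lra|left; apply Rinv_0_lt_compat; nra]).
      assert (Hmn : 2 * c / INR n <= 2 * c / INR m).
      { apply Rmult_le_compat_l; [lra|]. apply Rinv_le_contravar; [lra|apply le_INR; lia]. }
      set (s := 2 * c / INR n) in *. set (t := 2 * c / (INR n + 1)) in *.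
      assert (Ht : 0 <= t) by (apply Rmult_le_pos; [lra|left; apply Rinv_0_lt_compat; lra]).
      set (a := 1 - 2 * c / INR m + s) in *.
      assert (Ha : 0 <= a <= 1) by (unfold a; lra).
      assert (P0 := Cmod_ge_0 (rgamma_seq m v)).
      assert (Pn := Cmod_ge_0 (rgamma_seq n v)).
      assert (Y1 : y <= 1) by lra.
      apply Rle_trans with (Cmod (rgamma_seq n v) * (1 - y)).
      2:{ apply Rmult_le_compat_l; auto. }
      apply Rle_trans with (Cmod (rgamma_seq m v) * a * (1 - y)).
      2:{ apply Rmult_le_compat_r; lra. }
      rewrite Rmult_assoc. apply Rmult_le_compat_l; auto.
      assert (a * y <= y) by nra. unfold a in *. lra. }
  assert (H1 := INR_ge_1 n ltac:(lia)).
  assert (0 <= 2 * c / INR n) by (apply Rmult_le_pos; [lra|left; apply Rinv_0_lt_compat; lra]).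
  assert (B := Base v Hv Hk).
  apply Rle_trans with (Cmod (rgamma_seq m v) * (1 / 2)); [lra|].
  eapply Rle_trans; [|exact A]. apply Rmult_le_compat_l; [apply Cmod_ge_0|lra].
Qed.

Lemma rgamma_lower (r rho : R) : 0 <= r -> 0 < rho -> exists c, 0 < c /\
  forall v, Cmod v <= r ->
    (forall k, rho <= Cmod (v + RtoC (INR k))%C) -> c <= Cmod (rgamma v).
Proof.
  intros Hr Hrho. destruct (rgamma_seq_lower r rho Hr Hrho) as [c [n0 [Hc [Hn0 H]]]].
  exists c. split; auto. intros v Hv Hk. apply le_epsilon. intros eps He.
  destruct (proj1 (filterlim_Cmod _ _ _) (rgamma_seq_cvg v) eps He) as [m Hm].
  assert (A := H (n0 + m)%nat v ltac:(lia) Hv Hk). assert (B := Hm (n0 + m)%nat ltac:(lia)).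
  replace (rgamma_seq (n0 + m) v) with ((rgamma_seq (n0 + m) v - rgamma v) + rgamma v)%C in A by ring.
  eapply Rle_trans; [exact A|]. eapply Rle_trans; [apply Cmod_triangle|]. lra.
Qed.

Lemma rgamma_neq_0 (v : C) (rho : R) : 0 < rho ->
  (forall k, rho <= Cmod (v + RtoC (INR k))%C) -> rgamma v <> RtoC 0.
Proof.
  intros Hrho H. destruct (rgamma_lower (Cmod v) rho (Cmod_ge_0 v) Hrho) as [c [Hc Hv]].
  apply Cmod_gt_0. specialize (Hv v ltac:(lra) H). lra.
Qed.

(** * Identification with [CGamma], and the functional equation *)

Lemma rgamma_seq_mult_cvg (v : C) :
  filterlim (fun n => rgamma_seq n v * (1 + v / RtoC (INR n)))%C eventually (locally (rgamma v)).
Proof.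
  apply filterlim_Cmod; [typeclasses eauto|]. intros eps He.
  assert (Pv := Cmod_ge_0 v).
  destruct (rgamma_seq_error (Cmod v) Pv) as [D [HD H]].
  destruct (rgamma_seq_bounded (Cmod v) Pv) as [B [HB HB']].
  destruct (INR_archimed_div (D + B * Cmod v) eps He) as [n0 [Hn0 Hn0']].
  exists n0. intros n Hn. eapply Rle_lt_trans; [|apply Hn0'; exact Hn].
  assert (H1 := INR_ge_1 n ltac:(lia)).
  replace (rgamma_seq n v * (1 + v / RtoC (INR n)) - rgamma v)%C
    with ((rgamma_seq n v - rgamma v) + rgamma_seq n v * (v / RtoC (INR n)))%C by ring.
  eapply Rle_trans; [apply Cmod_triangle|].
  rewrite Cmod_mult, Cmod_div, Cmod_RtoC_pos by (try apply RtoC_neq_0; lra).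
  assert (A1 := H n v ltac:(lia) ltac:(lra)). assert (A2 := HB' n v ltac:(lia) ltac:(lra)).
  assert (0 <= Cmod v / INR n) by (apply Rmult_le_pos; [lra|left; apply Rinv_0_lt_compat; lra]).
  replace ((D + B * Cmod v) / INR n) with (D / INR n + B * (Cmod v / INR n)) by (field; lra).
  apply Rplus_le_compat; auto. now apply Rmult_le_compat_r.
Qed.

Lemma filterlim_Ccont {T : Type} (F : (T -> Prop) -> Prop) {FF : Filter F}
  (f : T -> C) (g : C -> C) (l : C) :
  Ccont g l -> filterlim f F (locally l) -> filterlim (fun t => g (f t)) F (locally (g l)).
Proof.
  intros Hg Hf. apply filterlim_Cmod; auto. intros eps He.
  destruct (Hg eps He) as [dl [Hd H]].
  generalize (proj1 (filterlim_Cmod _ _ _) Hf dl Hd). apply filter_imp. auto.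
Qed.

Lemma pochn_neq_0 (v : C) (n : nat) :
  (forall k, (v + RtoC (INR k))%C <> RtoC 0) -> pochn v n <> RtoC 0.
Proof.
  intros H. induction n as [|n IH]; simpl; [apply RtoC_neq_0; lra|].
  apply Cmult_neq_0; auto.
Qed.

(** The reciprocal of Gauss's n-th term is [rgamma_seq n v] times (v + n)/n, its last factor, which
    tends to 1. *)
Lemma CGamma_rgamma (v : C) (rho : R) : 0 < rho ->
  (forall k, rho <= Cmod (v + RtoC (INR k))%C) -> CGamma v = (/ rgamma v)%C.
Proof.
  intros Hrho H. apply Clim_seq_correct.
  assert (Hk : forall k, (v + RtoC (INR k))%C <> RtoC 0).
  { intros k. apply Cmod_gt_0. specialize (H k). lra. }
  apply (filterlim_ext_loc (fun n => / (rgamma_seq n v * (1 + v / RtoC (INR n))))%C).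
  - exists 1%nat. intros n Hn. assert (H1 := INR_ge_1 n Hn).
    assert (Nn : RtoC (INR n) <> RtoC 0) by (apply RtoC_neq_0; lra).
    assert (Np := pochn_neq_0 v n Hk). assert (Nk := Hk n).
    unfold rgamma_seq, cpowr. simpl pochn. rewrite cexp_opp.
    assert (Ne := cexp_neq_0 (v * RtoC (ln (INR n)))%C).
    rewrite (INR_fact_pred n Hn). assert (Nf := INR_fact_neq_0C (pred n)).
    field. repeat split; auto.
  - apply (filterlim_Ccont _ _ (fun z => / z)%C).
    + apply Ccont_inv; [now apply (rgamma_neq_0 v rho)|apply Ccont_id].
    + apply rgamma_seq_mult_cvg.
Qed.

Lemma pochn_rgamma_seq (n : nat) (v : C) :
  pochn v n = (RtoC (INR (fact (pred n))) * cexp (v * RtoC (ln (INR n))) * rgamma_seq n v)%C.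
Proof.
  unfold rgamma_seq. rewrite cexp_opp.
  assert (N1 := cexp_neq_0 (v * RtoC (ln (INR n)))%C). assert (N2 := INR_fact_neq_0C (pred n)).
  field. auto.
Qed.

Lemma rgamma_seq_neq_0 (n : nat) (v : C) :
  (forall k, (v + RtoC (INR k))%C <> RtoC 0) -> rgamma_seq n v <> RtoC 0.
Proof.
  intros H. apply (pochn_neq_0 v n) in H. rewrite pochn_rgamma_seq in H.
  intros E. apply H. rewrite E. ring.
Qed.

Lemma pochn_shift (v : C) (n : nat) :
  (v * pochn (v + 1) n)%C = (pochn v n * (v + RtoC (INR n)))%C.
Proof.
  induction n as [|n IH]; [simpl; ring|].
  simpl pochn. rewrite Cmult_assoc, IH, S_INR, RtoC_plus. ring.
Qed.

(** Both sides contain v (v + 1) ... (v + n), grouped differently. This is the functional equation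
    at finite n with its exact correction v/n; dividing by v gives the contraction factor 1/v + 1/n
    used along the rays. *)
Lemma rgamma_seq_shift (n : nat) (v : C) : (1 <= n)%nat ->
  (v * rgamma_seq n (v + 1))%C = (rgamma_seq n v * (1 + v / RtoC (INR n)))%C.
Proof.
  intros Hn. assert (H1 := INR_ge_1 n Hn).
  assert (Nn : RtoC (INR n) <> RtoC 0) by (apply RtoC_neq_0; lra).
  unfold rgamma_seq.
  replace (- ((v + 1) * RtoC (ln (INR n))))%C
    with (- (v * RtoC (ln (INR n))) + RtoC (- ln (INR n)))%C by (rewrite RtoC_opp; ring).
  rewrite cexp_plus, cexp_RtoC, exp_Ropp, exp_ln, RtoC_inv by lra.
  unfold Cdiv. rewrite !Cmult_assoc, pochn_shift. field. split; auto. apply INR_fact_neq_0C.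
Qed.

Lemma rgamma_shift (v : C) : (v * rgamma (v + 1))%C = rgamma v.
Proof.
  apply (@filterlim_locally_unique nat C_AbsRing C_NormedModule eventually _
    (fun n => rgamma_seq n v * (1 + v / RtoC (INR n)))%C).
  - apply (filterlim_ext_loc (fun n => v * rgamma_seq n (v + 1))%C).
    + exists 1%nat. intros n Hn. now apply rgamma_seq_shift.
    + apply (filterlim_Ccont _ _ (fun z => v * z)%C); [|apply rgamma_seq_cvg].
      apply Ccont_mult; [apply Ccont_const|apply Ccont_id].
  - apply rgamma_seq_mult_cvg.
Qed.

Lemma rgamma_shift_pochn (v : C) (p : nat) :
  (pochn v p * rgamma (v + RtoC (INR p)))%C = rgamma v.
Proof.
  induction p as [|p IH]; simpl pochn.
  - simpl INR. rewrite Cplus_0_r. ring.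
  - rewrite <- IH, <- (rgamma_shift (v + RtoC (INR p))%C).
    rewrite S_INR, RtoC_plus.
    replace (v + (RtoC (INR p) + 1))%C with (v + RtoC (INR p) + 1)%C by ring. ring.
Qed.

(** * Integration along the contour *)

Notation is_CInt := (@is_RInt C_R_NormedModule).
Notation ex_CInt := (@ex_RInt C_R_NormedModule).

Lemma CInt_correct (f : R -> C) (a b : R) : ex_CInt f a b -> is_CInt f a b (CInt f a b).
Proof. intros H. apply (@RInt_correct C_R_CompleteNormedModule). exact H. Qed.

Lemma CInt_unique (f : R -> C) (a b : R) (l : C) : is_CInt f a b l -> CInt f a b = l.
Proof. intros H. apply (@is_RInt_unique C_R_CompleteNormedModule). exact H. Qed.

Lemma is_CInt_plus (f g : R -> C) (a b : R) (lf lg : C) :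
  is_CInt f a b lf -> is_CInt g a b lg ->
  is_CInt (fun u => f u + g u)%C a b (lf + lg)%C.
Proof. intros Hf Hg. exact (is_RInt_plus (V := C_R_NormedModule) f g a b lf lg Hf Hg). Qed.

(** The integral lives in [C] as a real vector space, where a complex constant is not a scalar;
    hence the passage through real and imaginary parts. *)
Lemma is_CInt_mult (c : C) (f : R -> C) (a b : R) (l : C) :
  is_CInt f a b l -> is_CInt (fun u => c * f u)%C a b (c * l)%C.
Proof.
  intros H. destruct c as [c1 c2], l as [l1 l2].
  assert (H1 := is_RInt_fct_extend_fst (U := R_NormedModule) (V := R_NormedModule) f a b (l1, l2) H).
  assert (H2 := is_RInt_fct_extend_snd (U := R_NormedModule) (V := R_NormedModule) f a b (l1, l2) H).
  simpl in H1, H2.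
  apply (is_RInt_fct_extend_pair (U := R_NormedModule) (V := R_NormedModule)); simpl.
  - apply (is_RInt_minus (V := R_NormedModule));
      apply (is_RInt_scal (V := R_NormedModule)); auto.
  - apply (is_RInt_plus (V := R_NormedModule));
      apply (is_RInt_scal (V := R_NormedModule)); auto.
Qed.

Lemma is_CInt_reflect (f : R -> C) (a b : R) (l : C) :
  is_CInt (fun u => f (- u)) a b l -> is_CInt f (- b) (- a) l.
Proof.
  intros H. rewrite <- (Ropp_involutive a), <- (Ropp_involutive b) in H.
  apply (is_RInt_comp_opp (V := C_R_NormedModule)) in H.
  apply (is_RInt_swap (V := C_R_NormedModule)) in H.
  apply (is_RInt_opp (V := C_R_NormedModule)) in H.
  rewrite opp_opp in H.
  revert H. apply is_RInt_ext. intros x _. rewrite opp_opp, Ropp_involutive. reflexivity.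
Qed.

Lemma CInt_bound (f : R -> C) (g : R -> R) (a b lg : R) : a <= b -> ex_CInt f a b ->
  (forall u, a <= u <= b -> Cmod (f u) <= g u) -> is_RInt g a b lg ->
  Cmod (CInt f a b) <= lg.
Proof.
  intros Hab Hf H Hg. rewrite Cmod_norm.
  apply (norm_RInt_le (V := C_R_NormedModule) f g a b _ _ Hab); auto.
  - intros x Hx. specialize (H x Hx). rewrite Cmod_norm in H. exact H.
  - now apply CInt_correct.
Qed.

Lemma is_RInt_exp_opp (B a b : R) :
  is_RInt (fun u => B * exp (- u)) a b (B * exp (- a) - B * exp (- b)).
Proof.
  replace (B * exp (- a) - B * exp (- b))
    with (minus (- B * exp (- b)) (- B * exp (- a))) by (unfold minus, plus, opp; simpl; ring).
  apply (is_RInt_derive (fun u => - B * exp (- u))).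
  - intros x _. auto_derive; auto. ring.
  - intros x _. apply (ex_derive_continuous (fun u => B * exp (- u))). auto_derive; auto.
Qed.

(** Rate 1 suffices for the improper integrals; the faster decay established later serves to absorb
    exponentially growing factors. *)
Record exp_integrable (h : R -> C) (a B : R) : Prop := {
  exp_int_ex : forall T, a <= T -> ex_CInt h a T;
  exp_int_bd : forall u, a <= u -> Cmod (h u) <= B * exp (- u) }.

Lemma exp_integrable_coef_pos (h : R -> C) (a B : R) : exp_integrable h a B -> 0 <= B.
Proof.
  intros [_ H]. specialize (H a (Rle_refl a)).
  assert (P := Cmod_ge_0 (h a)). assert (E := exp_pos (- a)).
  destruct (Rle_lt_dec 0 B); auto. nra.
Qed.

Lemma CInt_tail (h : R -> C) (a B T1 T2 : R) : exp_integrable h a B ->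
  a <= T1 -> T1 <= T2 -> Cmod (CInt h a T2 - CInt h a T1)%C <= B * exp (- T1).
Proof.
  intros H H1 H2. assert (PB := exp_integrable_coef_pos _ _ _ H). destruct H as [He Hb].
  assert (E1 := He T1 H1). assert (E2 := He T2 ltac:(lra)).
  assert (E3 : ex_CInt h T1 T2).
  { apply (ex_RInt_Chasles (V := C_R_NormedModule)) with a; auto.
    apply (ex_RInt_swap (V := C_R_NormedModule)); auto. }
  assert (Ch := RInt_Chasles (V := C_R_CompleteNormedModule) h a T1 T2 E1 E3).
  replace (CInt h a T2 - CInt h a T1)%C with (CInt h T1 T2).
  2:{ unfold CInt. rewrite <- Ch. change (CInt h T1 T2 = (CInt h a T1 + CInt h T1 T2) - CInt h a T1)%C. ring. }
  eapply Rle_trans.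
  - apply (CInt_bound h (fun u => B * exp (- u)) T1 T2 _ H2 E3); [|apply is_RInt_exp_opp].
    intros u Hu. apply Hb. lra.
  - assert (P := exp_pos (- T2)). nra.
Qed.

Lemma exp_opp_small (B eps : R) : 0 <= B -> 0 < eps ->
  exists T0, forall T, T0 < T -> B * exp (- T) < eps.
Proof.
  intros HB He. exists (- ln (eps / (B + 1))). intros T HT.
  assert (P : 0 < eps / (B + 1)) by (apply Rdiv_lt_0_compat; lra).
  assert (A : exp (- T) < eps / (B + 1)).
  { rewrite <- (exp_ln _ P). apply exp_increasing. lra. }
  assert (Q := exp_pos (- T)).
  assert ((B + 1) * exp (- T) < eps).
  { apply (Rmult_lt_compat_l (B + 1)) in A; [|lra].
    replace ((B + 1) * (eps / (B + 1))) with eps in A by (field; lra). exact A. }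
  nra.
Qed.

Lemma CInt_pinfty_cvg (h : R -> C) (a B : R) : exp_integrable h a B ->
  filterlim (fun T => CInt h a T) (Rbar_locally p_infty) (locally (CInt_pinfty h a)).
Proof.
  intros H. assert (PB := exp_integrable_coef_pos _ _ _ H).
  unfold CInt_pinfty, Clim_pinfty. apply epsilon_spec.
  apply (@filterlim_locally_cauchy R C_R_CompleteNormedModule); [typeclasses eauto|].
  intros eps. destruct (exp_opp_small B eps PB (cond_pos eps)) as [T0 HT0].
  exists (fun T => Rmax a T0 < T). split; [now exists (Rmax a T0)|].
  assert (S : forall T1 T2, Rmax a T0 < T1 -> T1 <= T2 ->
    Cmod (CInt h a T2 - CInt h a T1)%C < eps).
  { intros T1 T2 A1 A2. assert (M1 := Rmax_l a T0). assert (M2 := Rmax_r a T0).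
    eapply Rle_lt_trans; [apply (CInt_tail h a B); auto; lra|]. apply HT0. lra. }
  intros T1 T2 A1 A2. apply C_NormedModule_mixin_compat1.
  change (Cmod (CInt h a T2 - CInt h a T1)%C < eps).
  destruct (Rle_lt_dec T1 T2); [now apply S|].
  rewrite Cmod_minus_comm. apply S; auto. lra.
Qed.

Lemma Clim_pinfty_correct (f : R -> C) (l : C) :
  filterlim f (Rbar_locally p_infty) (locally l) -> Clim_pinfty f = l.
Proof.
  intros H.
  apply (@filterlim_locally_unique R C_AbsRing C_NormedModule (Rbar_locally p_infty) _ f); auto.
  unfold Clim_pinfty. apply epsilon_spec. now exists l.
Qed.

Lemma Clim_minfty_correct (f : R -> C) (l : C) :
  filterlim f (Rbar_locally m_infty) (locally l) -> Clim_minfty f = l.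
Proof.
  intros H.
  apply (@filterlim_locally_unique R C_AbsRing C_NormedModule (Rbar_locally m_infty) _ f); auto.
  unfold Clim_minfty. apply epsilon_spec. now exists l.
Qed.

Lemma CInt_pinfty_bound (h : R -> C) (a B : R) : exp_integrable h a B ->
  Cmod (CInt_pinfty h a) <= B * exp (- a).
Proof.
  intros H. apply le_epsilon. intros eps He.
  destruct (proj1 (filterlim_Cmod _ _ _) (CInt_pinfty_cvg h a B H) eps He) as [T0 HT0].
  set (T := Rmax a T0 + 1). assert (M1 := Rmax_l a T0). assert (M2 := Rmax_r a T0).
  specialize (HT0 T ltac:(unfold T; lra)).
  assert (A := CInt_tail h a B a T H (Rle_refl a) ltac:(unfold T; lra)).
  assert (Z : CInt h a a = RtoC 0).
  { unfold CInt. rewrite (RInt_point (V := C_R_CompleteNormedModule)). reflexivity. }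
  rewrite Z in A.
  replace (CInt_pinfty h a) with (- (CInt h a T - CInt_pinfty h a) + (CInt h a T - 0))%C by ring.
  eapply Rle_trans; [apply Cmod_triangle|]. rewrite Cmod_opp. lra.
Qed.

(** Integrability enters because [Clim_pinfty] has a determined value only when the limit exists. *)
Lemma CInt_pinfty_ext (h1 h2 : R -> C) (a B : R) : exp_integrable h1 a B ->
  (forall u, a <= u -> h1 u = h2 u) -> CInt_pinfty h2 a = CInt_pinfty h1 a.
Proof.
  intros H E. apply Clim_pinfty_correct.
  apply (filterlim_ext_loc (fun T => CInt h1 a T)); [|now apply (CInt_pinfty_cvg h1 a B)].
  exists a. intros T HT. apply (RInt_ext (V := C_R_CompleteNormedModule)).
  intros u. rewrite Rmin_left, Rmax_right by lra. intros Hu. apply E. lra.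
Qed.

Lemma CInt_pinfty_plus (h1 h2 : R -> C) (a B1 B2 : R) :
  exp_integrable h1 a B1 -> exp_integrable h2 a B2 ->
  CInt_pinfty (fun u => h1 u + h2 u)%C a = (CInt_pinfty h1 a + CInt_pinfty h2 a)%C.
Proof.
  intros H1 H2. apply Clim_pinfty_correct.
  apply (filterlim_ext_loc (fun T => CInt h1 a T + CInt h2 a T)%C).
  - exists a. intros T HT. symmetry. apply CInt_unique, is_CInt_plus;
      apply CInt_correct; [apply H1|apply H2]; lra.
  - eapply filterlim_comp_2; [exact (CInt_pinfty_cvg h1 a B1 H1)|exact (CInt_pinfty_cvg h2 a B2 H2)|].
    apply (@filterlim_plus R_AbsRing C_R_NormedModule).
Qed.

Lemma CInt_pinfty_mult (c : C) (h : R -> C) (a B : R) : exp_integrable h a B ->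
  CInt_pinfty (fun u => c * h u)%C a = (c * CInt_pinfty h a)%C.
Proof.
  intros H. apply Clim_pinfty_correct.
  apply (filterlim_ext_loc (fun T => c * CInt h a T)%C).
  - exists a. intros T HT. symmetry. apply CInt_unique, is_CInt_mult, CInt_correct, H. lra.
  - apply (filterlim_Ccont _ (fun T => CInt h a T) (fun z => c * z)%C).
    + apply Ccont_mult; [apply Ccont_const|apply Ccont_id].
    + now apply (CInt_pinfty_cvg h a B).
Qed.

Lemma CInt_minfty_reflect (f : R -> C) (a B : R) :
  exp_integrable (fun u => f (- u)) a B ->
  CInt_minfty f (- a) = CInt_pinfty (fun u => f (- u)) a.
Proof.
  intros H. apply Clim_minfty_correct.
  apply (filterlim_ext_loc (fun T => CInt (fun u => f (- u)) a (- T))).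
  - exists (- a). intros T HT. symmetry. apply CInt_unique.
    rewrite <- (Ropp_involutive T) at 1. apply is_CInt_reflect, CInt_correct, H. lra.
  - eapply filterlim_comp; [|apply (CInt_pinfty_cvg _ a B H)].
    apply (filterlim_Rbar_opp m_infty).
Qed.

(** * Functions and integrals on the contour Gamma_+ *)

Definition on_Gplus (d : R) (z : C) : Prop :=
  (Re z = d /\ - d <= Im z <= d) \/ (d <= Re z /\ (Im z = d \/ Im z = - d)).

Record contour_integrable (d B : R) (g : C -> C) : Prop := {
  ci_up : forall T, d <= T -> ex_CInt (fun u => g (u, d)) d T;
  ci_down : forall T, d <= T -> ex_CInt (fun u => g (u, - d)) d T;
  ci_vert : ex_CInt (fun v => g (d, v)) (- d) d;
  ci_bound : forall z, on_Gplus d z -> Cmod (g z) <= B * exp (- Re z) }.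

Section Contour.
Variable d : R.
Hypothesis Hd : 0 < d.

Lemma contour_exp_up (B : R) (g : C -> C) : contour_integrable d B g ->
  exp_integrable (fun u => g (u, d)) d B.
Proof.
  intros [H1 H2 H3 H4]. split; auto. intros u Hu. apply (H4 (u, d)). right. simpl. auto.
Qed.

Lemma contour_exp_down (B : R) (g : C -> C) : contour_integrable d B g ->
  exp_integrable (fun u => g (u, - d)) d B.
Proof.
  intros [H1 H2 H3 H4]. split; auto. intros u Hu. apply (H4 (u, - d)). right. simpl. auto.
Qed.

Lemma contour_coef_pos (B : R) (g : C -> C) : contour_integrable d B g -> 0 <= B.
Proof. intros H. apply (exp_integrable_coef_pos _ _ _ (contour_exp_up _ _ H)). Qed.

Lemma contour_ex_vert (B : R) (g : C -> C) : contour_integrable d B g ->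
  ex_CInt (fun v => g (d, v) * Ci)%C (- d) d.
Proof.
  intros H. destruct (ci_vert _ _ _ H) as [l Hl]. exists (Ci * l)%C.
  apply is_RInt_ext with (fun v => Ci * g (d, v))%C; [intros; apply Cmult_comm|].
  now apply is_CInt_mult.
Qed.

(** Each ray contributes at most B exp(-d) <= B, and the segment of length 2d at most 2 d B. *)
Lemma int_Gplus_bound (B : R) (g : C -> C) : contour_integrable d B g ->
  Cmod (int_Gplus d g) <= B * (2 + 2 * d).
Proof.
  intros H. assert (PB := contour_coef_pos _ _ H). unfold int_Gplus.
  assert (E1 := CInt_pinfty_bound _ _ _ (contour_exp_up _ _ H)).
  assert (E2 := CInt_pinfty_bound _ _ _ (contour_exp_down _ _ H)).
  assert (Ee : exp (- d) <= 1) by (rewrite <- exp_0; left; apply exp_increasing; lra).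
  assert (Pe := exp_pos (- d)).
  assert (E3 : Cmod (CInt (fun v => g (d, v) * Ci)%C (- d) d) <= B * (2 * d)).
  { apply (CInt_bound _ (fun _ => B)); [lra|now apply (contour_ex_vert B)| |].
    - intros v Hv. rewrite Cmod_mult, Cmod_Ci, Rmult_1_r.
      eapply Rle_trans; [apply (ci_bound _ _ _ H); left; simpl; auto|]. simpl. nra.
    - replace (B * (2 * d)) with (scal (d - - d) B) by (unfold scal; simpl; unfold mult; simpl; ring).
      apply (is_RInt_const (V := R_NormedModule)). }
  eapply Rle_trans; [apply Cmod_triangle|].
  eapply Rle_trans; [apply Rplus_le_compat_r, Cmod_triangle|].
  rewrite Cmod_opp. nra.
Qed.

Lemma contour_integrable_ext (B : R) (g1 g2 : C -> C) : contour_integrable d B g1 ->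
  (forall z, on_Gplus d z -> g1 z = g2 z) -> contour_integrable d B g2.
Proof.
  intros [H1 H2 H3 H4] E.
  split.
  - intros T HT. apply (ex_RInt_ext (V := C_R_NormedModule)) with (2 := H1 T HT).
    rewrite Rmin_left, Rmax_right by lra. intros u Hu. apply E. right. simpl. split; auto; lra.
  - intros T HT. apply (ex_RInt_ext (V := C_R_NormedModule)) with (2 := H2 T HT).
    rewrite Rmin_left, Rmax_right by lra. intros u Hu. apply E. right. simpl. split; auto; lra.
  - apply (ex_RInt_ext (V := C_R_NormedModule)) with (2 := H3).
    rewrite Rmin_left, Rmax_right by lra. intros u Hu. apply E. left. simpl. split; auto; lra.
  - intros z Hz. rewrite <- E; auto.
Qed.

Lemma int_Gplus_ext (B : R) (g1 g2 : C -> C) : contour_integrable d B g1 ->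
  (forall z, on_Gplus d z -> g1 z = g2 z) -> int_Gplus d g2 = int_Gplus d g1.
Proof.
  intros H E. unfold int_Gplus. f_equal; [f_equal|].
  - f_equal. apply (CInt_pinfty_ext _ _ _ B (contour_exp_down _ _ H)).
    intros u Hu. apply E. right. simpl. auto.
  - apply (RInt_ext (V := C_R_CompleteNormedModule)).
    rewrite Rmin_left, Rmax_right by lra. intros u Hu. rewrite E; auto.
    left. simpl. split; auto; lra.
  - apply (CInt_pinfty_ext _ _ _ B (contour_exp_up _ _ H)).
    intros u Hu. apply E. right. simpl. auto.
Qed.

Lemma contour_integrable_plus (B1 B2 : R) (g1 g2 : C -> C) :
  contour_integrable d B1 g1 -> contour_integrable d B2 g2 ->
  contour_integrable d (B1 + B2) (fun z => g1 z + g2 z)%C.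
Proof.
  intros [H1 H2 H3 H4] [K1 K2 K3 K4]. split.
  - intros T HT. exact (ex_RInt_plus (V := C_R_NormedModule) _ _ _ _ (H1 T HT) (K1 T HT)).
  - intros T HT. exact (ex_RInt_plus (V := C_R_NormedModule) _ _ _ _ (H2 T HT) (K2 T HT)).
  - exact (ex_RInt_plus (V := C_R_NormedModule) _ _ _ _ H3 K3).
  - intros z Hz. eapply Rle_trans; [apply Cmod_triangle|].
    specialize (H4 z Hz). specialize (K4 z Hz). lra.
Qed.

Lemma contour_integrable_mult (B : R) (c : C) (g : C -> C) :
  contour_integrable d B g -> contour_integrable d (Cmod c * B) (fun z => c * g z)%C.
Proof.
  intros [H1 H2 H3 H4]. split.
  - intros T HT. destruct (H1 T HT) as [l Hl]. exists (c * l)%C. now apply is_CInt_mult.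
  - intros T HT. destruct (H2 T HT) as [l Hl]. exists (c * l)%C. now apply is_CInt_mult.
  - destruct H3 as [l Hl]. exists (c * l)%C. now apply is_CInt_mult.
  - intros z Hz. rewrite Cmod_mult, Rmult_assoc.
    apply Rmult_le_compat_l; [apply Cmod_ge_0|auto].
Qed.

Lemma int_Gplus_plus (B1 B2 : R) (g1 g2 : C -> C) :
  contour_integrable d B1 g1 -> contour_integrable d B2 g2 ->
  int_Gplus d (fun z => g1 z + g2 z)%C = (int_Gplus d g1 + int_Gplus d g2)%C.
Proof.
  intros H1 H2. unfold int_Gplus.
  rewrite (CInt_pinfty_plus _ _ _ _ _ (contour_exp_down _ _ H1) (contour_exp_down _ _ H2)).
  rewrite (CInt_pinfty_plus _ _ _ _ _ (contour_exp_up _ _ H1) (contour_exp_up _ _ H2)).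
  replace (CInt (fun v => (g1 (d, v) + g2 (d, v)) * Ci)%C (- d) d) with
    (CInt (fun v => g1 (d, v) * Ci)%C (- d) d + CInt (fun v => g2 (d, v) * Ci)%C (- d) d)%C.
  - ring.
  - symmetry. apply CInt_unique.
    apply is_RInt_ext with (fun v => g1 (d, v) * Ci + g2 (d, v) * Ci)%C.
    + intros. symmetry. apply Cmult_plus_distr_r.
    + apply is_CInt_plus; apply CInt_correct; [apply (contour_ex_vert B1)|apply (contour_ex_vert B2)]; auto.
Qed.

Lemma int_Gplus_mult (B : R) (c : C) (g : C -> C) : contour_integrable d B g ->
  int_Gplus d (fun z => c * g z)%C = (c * int_Gplus d g)%C.
Proof.
  intros H. unfold int_Gplus.
  rewrite (CInt_pinfty_mult _ _ _ _ (contour_exp_down _ _ H)).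
  rewrite (CInt_pinfty_mult _ _ _ _ (contour_exp_up _ _ H)).
  replace (CInt (fun v => c * g (d, v) * Ci)%C (- d) d)
    with (c * CInt (fun v => g (d, v) * Ci) (- d) d)%C.
  - ring.
  - symmetry. apply CInt_unique.
    apply is_RInt_ext with (fun v => c * (g (d, v) * Ci))%C.
    + intros. apply Cmult_assoc.
    + apply is_CInt_mult, CInt_correct, (contour_ex_vert B); auto.
Qed.

Lemma int_Gplus_minus (B1 B2 : R) (g1 g2 : C -> C) :
  contour_integrable d B1 g1 -> contour_integrable d B2 g2 ->
  (int_Gplus d g1 - int_Gplus d g2)%C = int_Gplus d (fun z => g1 z - g2 z)%C.
Proof.
  intros H1 H2.
  assert (K2 := contour_integrable_mult _ (RtoC (-1)) _ H2).
  assert (K := contour_integrable_plus _ _ _ _ H1 K2).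
  rewrite (int_Gplus_ext _ _ (fun z => g1 z - g2 z)%C K).
  - rewrite (int_Gplus_plus _ _ _ _ H1 K2), (int_Gplus_mult _ _ _ H2).
    ring.
  - intros z _. ring.
Qed.

(** Negation carries Gamma_- to Gamma_+ traversed backwards, and the differential also changes sign;
    the two signs cancel. *)
Lemma int_Gminus_reflect (B : R) (g : C -> C) :
  contour_integrable d B (fun z => g (- z)%C) ->
  int_Gminus d g = int_Gplus d (fun z => g (- z)%C).
Proof.
  intros H. unfold int_Gminus.
  assert (U := contour_exp_up _ _ H). assert (D := contour_exp_down _ _ H).
  assert (U' : exp_integrable (fun u => g (- u, - d)) d B) by exact U.
  assert (D' : exp_integrable (fun u => g (- u, d)) d B).
  { assert (E : (fun u => g (- u, d)) = (fun u => g (- (u, (- d)%R))%C)).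
    { apply functional_extensionality. intros u.
      unfold Copp; simpl. now rewrite Ropp_involutive. }
    rewrite E. exact D. }
  rewrite (CInt_minfty_reflect (fun u => g (u, - d)) _ _ U').
  rewrite (CInt_minfty_reflect (fun u => g (u, d)) _ _ D').
  unfold int_Gplus.
  replace (CInt_pinfty (fun u => g (- u, d)) d) with (CInt_pinfty (fun u => g (- (u, (- d)%R))%C) d).
  2:{ apply (CInt_pinfty_ext _ _ _ B D'). intros u _. unfold Copp; simpl.
      now rewrite Ropp_involutive. }
  replace (CInt (fun v => g ((- d)%R, v) * Ci)%C (- d) d)
    with (CInt (fun v => g (- (d, v)) * Ci)%C (- d) d).
  2:{ symmetry. apply CInt_unique.
      assert (V := CInt_correct _ _ _ (contour_ex_vert _ _ H)).
      apply (is_CInt_reflect (fun v => g ((- d)%R, v) * Ci)%C (- d) d) in V.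
      rewrite Ropp_involutive in V. exact V. }
  change (fun u => g (- u, - d)) with (fun u => g (- (u, d))%C).
  ring.
Qed.

Lemma continuous_horizontal (g : C -> C) (u v : R) : Ccont g (u, v) ->
  @continuous R_UniformSpace C_R_NormedModule (fun u => g (u, v)) u.
Proof.
  intros H. apply filterlim_Cmod; [typeclasses eauto|]. intros eps He.
  destruct (H eps He) as [dl [Hdl H']]. exists (mkposreal _ Hdl). intros u' Hu'.
  apply H'. replace ((u', v) - (u, v))%C with (RtoC (u' - u))
    by (apply injective_projections; simpl; ring).
  rewrite Cmod_R. exact Hu'.
Qed.

Lemma continuous_vertical (g : C -> C) (u v : R) : Ccont g (u, v) ->
  @continuous R_UniformSpace C_R_NormedModule (fun v => g (u, v)) v.
Proof.
  intros H. apply filterlim_Cmod; [typeclasses eauto|]. intros eps He.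
  destruct (H eps He) as [dl [Hdl H']]. exists (mkposreal _ Hdl). intros v' Hv'.
  apply H'. replace ((u, v') - (u, v))%C with (Ci * RtoC (v' - v))%C
    by (apply injective_projections; simpl; ring).
  rewrite Cmod_mult, Cmod_Ci, Cmod_R, Rmult_1_l. exact Hv'.
Qed.

Lemma contour_integrable_cont (B : R) (g : C -> C) :
  (forall z, on_Gplus d z -> Ccont g z) ->
  (forall z, on_Gplus d z -> Cmod (g z) <= B * exp (- Re z)) ->
  contour_integrable d B g.
Proof.
  intros Hc Hb. split; auto.
  - intros T HT. apply (ex_RInt_continuous (V := C_R_CompleteNormedModule)).
    rewrite Rmin_left, Rmax_right by lra. intros u Hu.
    apply continuous_horizontal, Hc. right. simpl. split; auto; lra.
  - intros T HT. apply (ex_RInt_continuous (V := C_R_CompleteNormedModule)).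
    rewrite Rmin_left, Rmax_right by lra. intros u Hu.
    apply continuous_horizontal, Hc. right. simpl. split; auto; lra.
  - apply (ex_RInt_continuous (V := C_R_CompleteNormedModule)).
    rewrite Rmin_left, Rmax_right by lra. intros u Hu.
    apply continuous_vertical, Hc. left. simpl. split; auto; lra.
Qed.

End Contour.

(** * The double contour integral as a bilinear form *)

Record exp_decaying (d B : R) (a : C -> C) : Prop := {
  ed_cont : forall z, on_Gplus d z -> Ccont a z;
  ed_bound : forall z, on_Gplus d z -> Cmod (a z) <= B * exp (- Re z) }.

(** The inner integral after w is replaced by -w: the Cauchy kernel 1/(z - w) has become 1/(z + w),
    with w on Gamma_+. *)
Definition cauchy_transform (d : R) (b : C -> C) (z : C) : C :=
  int_Gplus d (fun w => b w / (z + w))%C.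

Definition double_transform (d : R) (a b : C -> C) : C :=
  int_Gplus d (fun z => a z * cauchy_transform d b z)%C.

Section CauchyTransform.
Variable d : R.
Hypothesis Hd : 0 < d.

Lemma on_Gplus_Re (z : C) : on_Gplus d z -> d <= Re z.
Proof. intros [[-> _]|[H _]]; lra. Qed.

Lemma on_Gplus_Im (z : C) : on_Gplus d z -> Rabs (Im z) <= d.
Proof. intros [[_ H]|[_ [H|H]]]; apply Rabs_le; lra. Qed.

(** Only the half plane Re z >= 0 is asked of z, since [Ccont] also evaluates the Cauchy transform
    at points near the contour but off it. *)
Lemma Cmod_sum_ge (z w : C) : 0 <= Re z -> on_Gplus d w -> d <= Cmod (z + w)%C.
Proof.
  intros Hz Hw. apply on_Gplus_Re in Hw.
  eapply Rle_trans; [|apply re_le_Cmod].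
  eapply Rle_trans; [|apply Rle_abs]. destruct z, w; simpl in *. lra.
Qed.

Lemma sum_neq_0 (z w : C) : 0 <= Re z -> on_Gplus d w -> (z + w)%C <> RtoC 0.
Proof. intros Hz Hw. apply Cmod_gt_0. assert (H := Cmod_sum_ge z w Hz Hw). lra. Qed.

Lemma Cmod_inv_sum_le (z w : C) : 0 <= Re z -> on_Gplus d w -> Cmod (/ (z + w))%C <= / d.
Proof.
  intros Hz Hw. rewrite Cmod_inv by (now apply sum_neq_0).
  apply Rinv_le_contravar; auto. now apply Cmod_sum_ge.
Qed.

Lemma exp_decaying_coef_pos (B : R) (b : C -> C) : exp_decaying d B b -> 0 <= B.
Proof.
  intros [_ H].
  assert (G : on_Gplus d (d, d)) by (left; simpl; lra).
  specialize (H _ G). assert (P := Cmod_ge_0 (b (d, d))).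
  assert (E := exp_pos (- Re (d, d))). destruct (Rle_lt_dec 0 B); auto. nra.
Qed.

Lemma exp_decaying_mult (B K : R) (b m : C -> C) : exp_decaying d B b ->
  (forall w, on_Gplus d w -> Ccont m w) ->
  (forall w, on_Gplus d w -> Cmod (m w) <= K) ->
  exp_decaying d (B * K) (fun w => b w * m w)%C.
Proof.
  intros [Hc Hb] Mc Mb. split.
  - intros w Hw. apply Ccont_mult; auto.
  - intros w Hw. rewrite Cmod_mult.
    replace (B * K * exp (- Re w)) with (B * exp (- Re w) * K) by ring.
    apply Rmult_le_compat; auto; apply Cmod_ge_0.
Qed.

Lemma exp_decaying_integrable (B : R) (b : C -> C) :
  exp_decaying d B b -> contour_integrable d B b.
Proof. intros [Hc Hb]. now apply contour_integrable_cont. Qed.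

Lemma Ccont_inv_sum (z w : C) : 0 <= Re z -> on_Gplus d w -> Ccont (fun w => / (z + w))%C w.
Proof.
  intros Hz Hw. apply (Ccont_inv (fun w => z + w)%C); [now apply sum_neq_0|].
  apply Ccont_plus; [apply Ccont_const|apply Ccont_id].
Qed.

Lemma cauchy_kernel_integrable (B : R) (b : C -> C) (z : C) :
  exp_decaying d B b -> 0 <= Re z ->
  contour_integrable d (B * / d) (fun w => b w / (z + w))%C.
Proof.
  intros H Hz. apply exp_decaying_integrable.
  apply (exp_decaying_mult B (/ d) b (fun w => / (z + w))%C); auto.
  - intros w Hw. now apply Ccont_inv_sum.
  - intros w Hw. now apply Cmod_inv_sum_le.
Qed.

Lemma cauchy_transform_bound (B : R) (b : C -> C) (z : C) :
  exp_decaying d B b -> 0 <= Re z ->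
  Cmod (cauchy_transform d b z) <= B * / d * (2 + 2 * d).
Proof.
  intros H Hz. apply int_Gplus_bound; auto. now apply cauchy_kernel_integrable.
Qed.

Lemma cauchy_transform_minus (B1 B2 : R) (b1 b2 : C -> C) (z : C) :
  exp_decaying d B1 b1 -> exp_decaying d B2 b2 -> 0 <= Re z ->
  (cauchy_transform d b1 z - cauchy_transform d b2 z)%C
    = cauchy_transform d (fun w => b1 w - b2 w)%C z.
Proof.
  intros H1 H2 Hz. unfold cauchy_transform.
  rewrite (int_Gplus_minus d Hd (B1 * / d) (B2 * / d)) by (now apply cauchy_kernel_integrable).
  f_equal. apply functional_extensionality. intros w. unfold Cdiv. ring.
Qed.

(** From 1/(z' + w) - 1/(z + w) = (z - z')/((z + w)(z' + w)), whose denominators are each at least d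
    in modulus. *)
Lemma cauchy_transform_lipschitz (B : R) (b : C -> C) (z z' : C) :
  exp_decaying d B b -> 0 <= Re z -> 0 <= Re z' ->
  Cmod (cauchy_transform d b z' - cauchy_transform d b z)%C
    <= B * (/ d * / d * (2 + 2 * d)) * Cmod (z' - z)%C.
Proof.
  intros H Hz Hz'. unfold cauchy_transform.
  rewrite (int_Gplus_minus d Hd (B * / d) (B * / d)) by (now apply cauchy_kernel_integrable).
  assert (I : contour_integrable d (Cmod (z - z')%C * (B * (/ d * / d)))
    (fun w => (z - z') * (b w * (/ (z + w) * / (z' + w))))%C).
  { apply contour_integrable_mult, exp_decaying_integrable.
    apply (exp_decaying_mult B (/ d * / d) b (fun w => / (z + w) * / (z' + w))%C); auto.
    - intros w Hw. apply Ccont_mult; now apply Ccont_inv_sum.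
    - intros w Hw. rewrite Cmod_mult.
      apply Rmult_le_compat; try apply Cmod_ge_0; now apply Cmod_inv_sum_le. }
  assert (E := int_Gplus_ext d Hd _ _ (fun w => b w / (z' + w) - b w / (z + w))%C I).
  rewrite E.
  - eapply Rle_trans; [apply (int_Gplus_bound d Hd _ _ I)|].
    rewrite (Cmod_minus_comm z z'). right. ring.
  - intros w Hw. assert (N1 := sum_neq_0 z w Hz Hw). assert (N2 := sum_neq_0 z' w Hz' Hw).
    field. auto.
Qed.

Lemma Ccont_cauchy_transform (B : R) (b : C -> C) (z : C) :
  exp_decaying d B b -> on_Gplus d z -> Ccont (cauchy_transform d b) z.
Proof.
  intros H Hz. assert (Rz := on_Gplus_Re z Hz). intros eps He.
  assert (PB := exp_decaying_coef_pos B b H).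
  set (K := B * (/ d * / d * (2 + 2 * d))).
  assert (HK : 0 <= K).
  { assert (0 < / d) by now apply Rinv_0_lt_compat.
    apply Rmult_le_pos; auto. apply Rmult_le_pos; nra. }
  (* Radius d keeps z' in Re >= 0, because Re z >= d on the contour; K + 1 avoids dividing by
     zero. *)
  exists (Rmin d (eps / (K + 1))). split.
  - apply Rmin_pos; auto. apply Rdiv_lt_0_compat; lra.
  - intros z' Hz'. assert (A1 := Rlt_le_trans _ _ _ Hz' (Rmin_l _ _)).
    assert (A2 := Rlt_le_trans _ _ _ Hz' (Rmin_r _ _)).
    assert (Rz' : 0 <= Re z').
    { assert (T := Rle_trans _ _ _ (Rle_abs _) (re_le_Cmod (z - z')%C)).
      rewrite Cmod_minus_comm in T. destruct z, z'; simpl in *. lra. }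
    eapply Rle_lt_trans; [apply (cauchy_transform_lipschitz B); auto; lra|]. fold K.
    apply (Rmult_lt_compat_l (K + 1)) in A2; [|lra].
    replace ((K + 1) * (eps / (K + 1))) with eps in A2 by (field; lra).
    assert (P := Cmod_ge_0 (z' - z)%C). lra.
Qed.

Lemma transform_decaying (A B : R) (a b : C -> C) :
  exp_decaying d A a -> exp_decaying d B b ->
  exp_decaying d (A * (B * / d * (2 + 2 * d))) (fun z => a z * cauchy_transform d b z)%C.
Proof.
  intros Ha Hb. apply exp_decaying_mult; auto.
  - intros z Hz. now apply (Ccont_cauchy_transform B).
  - intros z Hz. apply cauchy_transform_bound; auto. apply on_Gplus_Re in Hz. lra.
Qed.

Lemma exp_decaying_minus (A1 A2 e : R) (a1 a2 : C -> C) :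
  exp_decaying d A1 a1 -> exp_decaying d A2 a2 ->
  (forall z, on_Gplus d z -> Cmod (a1 z - a2 z)%C <= e * exp (- Re z)) ->
  exp_decaying d e (fun z => a1 z - a2 z)%C.
Proof.
  intros [C1 _] [C2 _] H. split; auto. intros z Hz. apply Ccont_minus; auto.
Qed.

(** Bilinearity in the form a1 b1 - a2 b2 = (a1 - a2) b1 + a2 (b1 - b2). The constant has 1/d from
    the kernel and 2 + 2d from each of the two integrals. *)
Lemma double_transform_diff (A1 A2 B1 B2 ea eb : R) (a1 a2 b1 b2 : C -> C) :
  exp_decaying d A1 a1 -> exp_decaying d A2 a2 ->
  exp_decaying d B1 b1 -> exp_decaying d B2 b2 ->
  (forall z, on_Gplus d z -> Cmod (a1 z - a2 z)%C <= ea * exp (- Re z)) ->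
  (forall z, on_Gplus d z -> Cmod (b1 z - b2 z)%C <= eb * exp (- Re z)) ->
  Cmod (double_transform d a1 b1 - double_transform d a2 b2)%C
    <= (ea * B1 + A2 * eb) * (/ d * (2 + 2 * d) * (2 + 2 * d)).
Proof.
  intros HA1 HA2 HB1 HB2 Ha Hb.
  assert (Da := exp_decaying_minus _ _ _ _ _ HA1 HA2 Ha).
  assert (Db := exp_decaying_minus _ _ _ _ _ HB1 HB2 Hb).
  assert (T1 := exp_decaying_integrable _ _ (transform_decaying _ _ _ _ Da HB1)).
  assert (T2 := exp_decaying_integrable _ _ (transform_decaying _ _ _ _ HA2 Db)).
  assert (T := contour_integrable_plus d _ _ _ _ T1 T2).
  unfold double_transform.
  rewrite (int_Gplus_minus d Hd _ _ _ _
    (exp_decaying_integrable _ _ (transform_decaying _ _ _ _ HA1 HB1))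
    (exp_decaying_integrable _ _ (transform_decaying _ _ _ _ HA2 HB2))).
  rewrite (int_Gplus_ext d Hd _ _ (fun z =>
    a1 z * cauchy_transform d b1 z - a2 z * cauchy_transform d b2 z)%C T).
  - eapply Rle_trans; [apply (int_Gplus_bound d Hd _ _ T)|]. right. ring.
  - intros z Hz. rewrite <- (cauchy_transform_minus B1 B2) by (auto; apply on_Gplus_Re in Hz; lra).
    ring.
Qed.

(** Integrability of the original inner integrand is not assumed: it is transported from the
    factored form, where decay is known, and only then may reflection and the extraction of
    constants be applied to the chosen limits. *)
Lemma Kdouble_transform (A B : R) (a b : C -> C) (Fr : C -> C -> C) (x y : R) :
  exp_decaying d A a -> exp_decaying d B b ->
  (forall z w, on_Gplus d z -> on_Gplus d w ->
    (Fr z (- w) * (cpowr x z / cpowr y (- w)))%C = (a z * b w)%C) ->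
  Kdouble d Fr x y = (RtoC (/ sqrt (x * y)) * (/ (RtoC (2 * PI) * Ci) *
    (/ (RtoC (2 * PI) * Ci) * double_transform d a b)))%C.
Proof.
  intros Ha Hb HF. unfold Kdouble. do 2 f_equal.
  set (k := (/ (RtoC (2 * PI) * Ci))%C).
  assert (I := exp_decaying_integrable _ _ (transform_decaying _ _ _ _ Ha Hb)).
  unfold double_transform. rewrite <- (int_Gplus_mult d _ k _ I).
  apply (int_Gplus_ext d Hd _ _ _ (contour_integrable_mult d _ k _ I)).
  intros z Hz. f_equal. assert (Rz := on_Gplus_Re z Hz).
  assert (J := cauchy_kernel_integrable B b z Hb ltac:(lra)).
  assert (Ja := contour_integrable_mult d _ (a z) _ J).
  assert (E : forall w, on_Gplus d w -> (a z * (b w / (z + w)))%C =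
    (Fr z (- w) * (cpowr x z / cpowr y (- w)) / (z - - w))%C).
  { intros w Hw. rewrite HF by auto. replace (z - - w)%C with (z + w)%C by ring.
    unfold Cdiv. ring. }
  rewrite (int_Gminus_reflect d _ (fun w => Fr z w * (cpowr x z / cpowr y w) / (z - w))%C
    (contour_integrable_ext d Hd _ _ _ Ja E)).
  rewrite (int_Gplus_ext d Hd _ _ _ Ja E).
  symmetry. apply (int_Gplus_mult d _ _ _ J).
Qed.

End CauchyTransform.

(** * Convergence in exponentially weighted norms *)

(** Convergence in all the norms sup |h(z)| exp(K Re z). The rate K is quantified outside the
    filter, so the threshold may depend on it, as the finite-index decay requires. *)
Record weighted_cvg (d : R) {T : Type} (F : (T -> Prop) -> Prop)
    (f : T -> C -> C) (g : C -> C) : Prop := {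
  wc_cont : F (fun t => forall z, on_Gplus d z -> Ccont (f t) z);
  wc_cont_lim : forall z, on_Gplus d z -> Ccont g z;
  wc_bound : forall K, 0 <= K -> exists B, 0 <= B /\
    forall z, on_Gplus d z -> Cmod (g z) <= B * exp (- (K * Re z));
  wc_cvg : forall K eps, 0 <= K -> 0 < eps ->
    F (fun t => forall z, on_Gplus d z -> Cmod (f t z - g z)%C <= eps * exp (- (K * Re z))) }.

Record exp_growing (d : R) (m : C -> C) : Prop := {
  eg_cont : forall z, on_Gplus d z -> Ccont m z;
  eg_bound : exists A k, 0 <= A /\ 0 <= k /\
    forall z, on_Gplus d z -> Cmod (m z) <= A * exp (k * Re z) }.

Lemma exp_le_mono (a b : R) : a <= b -> exp a <= exp b.
Proof. intros [H|H]; [left; now apply exp_increasing|rewrite H; lra]. Qed.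

Section Weighted.
Variable d : R.
Hypothesis Hd : 0 < d.

Lemma weighted_cvg_comp {T S : Type} (F : (T -> Prop) -> Prop) (G : (S -> Prop) -> Prop)
  (phi : S -> T) (f : T -> C -> C) (g : C -> C) :
  filterlim phi G F -> weighted_cvg d F f g -> weighted_cvg d G (fun s => f (phi s)) g.
Proof.
  intros Hphi [H1 H2 H3 H4]. split; auto.
  - exact (Hphi _ H1).
  - intros K eps HK He. exact (Hphi _ (H4 K eps HK He)).
Qed.

Lemma weighted_cvg_mult {T : Type} (F : (T -> Prop) -> Prop) {FF : Filter F}
  (f1 f2 : T -> C -> C) (g1 g2 : C -> C) :
  weighted_cvg d F f1 g1 -> weighted_cvg d F f2 g2 ->
  weighted_cvg d F (fun t z => f1 t z * f2 t z)%C (fun z => g1 z * g2 z)%C.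
Proof.
  intros [H1 H2 H3 H4] [K1 K2 K3 K4]. split.
  - generalize (filter_and _ _ H1 K1). apply filter_imp. intros t [A B] z Hz.
    apply Ccont_mult; auto.
  - intros z Hz. apply Ccont_mult; auto.
  - intros K HK. destruct (H3 K HK) as [B1 [PB1 HB1]].
    destruct (K3 0 ltac:(lra)) as [B2 [PB2 HB2]].
    exists (B1 * B2). split; [now apply Rmult_le_pos|]. intros z Hz.
    rewrite Cmod_mult. specialize (HB1 z Hz). specialize (HB2 z Hz).
    rewrite Rmult_0_l, Ropp_0, exp_0, Rmult_1_r in HB2.
    replace (B1 * B2 * exp (- (K * Re z))) with (B1 * exp (- (K * Re z)) * B2) by ring.
    apply Rmult_le_compat; auto; apply Cmod_ge_0.
  - intros K eps HK He.
    destruct (H3 0 ltac:(lra)) as [B1 [PB1 HB1]]. destruct (K3 0 ltac:(lra)) as [B2 [PB2 HB2]].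
    (* With E the weight, the three error terms are at most e E, B1 e E and B2 e E; the quadratic
       one uses e <= 1 and E <= 1. *)
    set (S := 2 * (B1 + B2 + 1)).
    set (e := Rmin 1 (eps / S)).
    assert (HS : 0 < S) by (unfold S; lra).
    assert (Pe : 0 < e) by (unfold e; apply Rmin_pos; [lra|now apply Rdiv_lt_0_compat]).
    assert (Se : e * S <= eps).
    { apply Rle_trans with (eps / S * S); [|right; field; lra].
      apply Rmult_le_compat_r; [lra|apply Rmin_r]. }
    assert (Le : e <= 1) by apply Rmin_l.
    generalize (filter_and _ _ (H4 K e HK Pe) (K4 K e HK Pe)).
    apply filter_imp. intros t [A B] z Hz. specialize (A z Hz). specialize (B z Hz).
    specialize (HB1 z Hz). specialize (HB2 z Hz).
    rewrite Rmult_0_l, Ropp_0, exp_0, Rmult_1_r in HB1, HB2.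
    replace (f1 t z * f2 t z - g1 z * g2 z)%C with
      ((f1 t z - g1 z) * (f2 t z - g2 z) + (g1 z * (f2 t z - g2 z) + (f1 t z - g1 z) * g2 z))%C
      by ring.
    assert (Rz := on_Gplus_Re d z Hz).
    set (E := exp (- (K * Re z))) in *.
    assert (PE : 0 < E) by apply exp_pos.
    assert (E1 : E <= 1) by (unfold E; rewrite <- exp_0; apply exp_le_mono; nra).
    eapply Rle_trans; [apply Cmod_triangle|].
    eapply Rle_trans; [apply Rplus_le_compat_l, Cmod_triangle|]. rewrite !Cmod_mult.
    assert (P1 := Cmod_ge_0 (f1 t z - g1 z)%C). assert (P2 := Cmod_ge_0 (f2 t z - g2 z)%C).
    assert (Q1 := Cmod_ge_0 (g1 z)). assert (Q2 := Cmod_ge_0 (g2 z)).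
    assert (T1 : Cmod (f1 t z - g1 z)%C * Cmod (f2 t z - g2 z)%C <= 1 * (e * E)).
    { apply Rmult_le_compat; auto. apply Rle_trans with (e * E); auto. nra. }
    assert (T2 : Cmod (g1 z) * Cmod (f2 t z - g2 z)%C <= B1 * (e * E))
      by (apply Rmult_le_compat; auto).
    assert (T3 : Cmod (f1 t z - g1 z)%C * Cmod (g2 z) <= (e * E) * B2)
      by (apply Rmult_le_compat; auto).
    apply Rle_trans with (e * S * E); [|apply Rmult_le_compat_r; lra].
    assert (0 <= e * E) by nra. unfold S. nra.
Qed.

(** A multiplier of growth exp(k Re z) is paid for by using the rate K + k in place of K, which is
    possible because every rate is available. *)
Lemma weighted_cvg_growing {T : Type} (F : (T -> Prop) -> Prop) {FF : Filter F}
  (m : C -> C) (f : T -> C -> C) (g : C -> C) :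
  exp_growing d m -> weighted_cvg d F f g ->
  weighted_cvg d F (fun t z => m z * f t z)%C (fun z => m z * g z)%C.
Proof.
  intros [Mc [A [k [HA [Hk Mb]]]]] [H1 H2 H3 H4].
  assert (W : forall K z y, on_Gplus d z -> 0 <= y ->
    Cmod (m z) * (y * exp (- ((K + k) * Re z))) <= A * y * exp (- (K * Re z))).
  { intros K z y Hz Hy.
    replace (A * y * exp (- (K * Re z)))
      with (A * exp (k * Re z) * (y * exp (- ((K + k) * Re z)))).
    - apply Rmult_le_compat_r; auto. apply Rmult_le_pos; auto. left; apply exp_pos.
    - replace (- (K * Re z)) with (k * Re z + - ((K + k) * Re z)) by ring.
      rewrite exp_plus. ring. }
  split.
  - revert H1. apply filter_imp. intros t H z Hz. apply (Ccont_mult m (f t)); auto.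
  - intros z Hz. apply Ccont_mult; auto.
  - intros K HK. destruct (H3 (K + k)) as [B [PB HB]]; [lra|].
    exists (A * B). split; [now apply Rmult_le_pos|]. intros z Hz. rewrite Cmod_mult.
    eapply Rle_trans; [|now apply W].
    apply Rmult_le_compat_l; [apply Cmod_ge_0|auto].
  - intros K eps HK He.
    assert (He' : 0 < eps / (A + 1)) by (apply Rdiv_lt_0_compat; lra).
    generalize (H4 (K + k) _ ltac:(lra) He'). apply filter_imp. intros t H z Hz.
    replace (m z * f t z - m z * g z)%C with (m z * (f t z - g z))%C by ring.
    rewrite Cmod_mult.
    eapply Rle_trans; [apply Rmult_le_compat_l; [apply Cmod_ge_0|apply H; auto]|].
    eapply Rle_trans; [apply W; auto; lra|].
    apply Rmult_le_compat_r; [left; apply exp_pos|].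
    apply Rle_trans with ((A + 1) * (eps / (A + 1))); [nra|right; field; lra].
Qed.

Lemma exp_growing_mult (m1 m2 : C -> C) :
  exp_growing d m1 -> exp_growing d m2 -> exp_growing d (fun z => m1 z * m2 z)%C.
Proof.
  intros [C1 [A1 [k1 [HA1 [Hk1 B1]]]]] [C2 [A2 [k2 [HA2 [Hk2 B2]]]]]. split.
  - intros z Hz. apply Ccont_mult; auto.
  - exists (A1 * A2), (k1 + k2). repeat split; [now apply Rmult_le_pos|lra|].
    intros z Hz. rewrite Cmod_mult, Rmult_plus_distr_r, exp_plus.
    replace (A1 * A2 * (exp (k1 * Re z) * exp (k2 * Re z)))
      with (A1 * exp (k1 * Re z) * (A2 * exp (k2 * Re z))) by ring.
    apply Rmult_le_compat; auto; apply Cmod_ge_0.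
Qed.

Lemma exp_growing_const (c : C) : exp_growing d (fun _ => c).
Proof.
  split; [intros; apply Ccont_const|].
  exists (Cmod c), 0. repeat split; try lra; [apply Cmod_ge_0|].
  intros. rewrite Rmult_0_l, exp_0. lra.
Qed.

Lemma Cmod_on_Gplus (z : C) : on_Gplus d z -> Cmod z <= Re z + d.
Proof.
  intros Hz. eapply Rle_trans; [apply Cmod_le_parts|].
  assert (A := on_Gplus_Im d Hd z Hz). assert (B := on_Gplus_Re d z Hz).
  rewrite (Rabs_right (Re z)) by lra. lra.
Qed.

Lemma exp_growing_affine (u c : C) : exp_growing d (fun z => u + c * z)%C.
Proof.
  split.
  - intros z Hz. apply Ccont_plus; [apply Ccont_const|].
    apply Ccont_mult; [apply Ccont_const|apply Ccont_id].
  - assert (Pu := Cmod_ge_0 u). assert (Pc := Cmod_ge_0 c).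
    exists (Cmod u + Cmod c * (1 + d)), 1. repeat split; [nra|lra|].
    intros z Hz. eapply Rle_trans; [apply Cmod_triangle|]. rewrite Cmod_mult, Rmult_1_l.
    assert (A := Cmod_on_Gplus z Hz). assert (B := on_Gplus_Re d z Hz).
    assert (E := exp_ineq1_le (Re z)).
    assert (Cmod z <= (1 + d) * exp (Re z)) by nra.
    assert (Cmod c * Cmod z <= Cmod c * ((1 + d) * exp (Re z))) by (now apply Rmult_le_compat_l).
    assert (Cmod u * 1 <= Cmod u * exp (Re z)) by (apply Rmult_le_compat_l; lra).
    lra.
Qed.

Lemma exp_growing_pochn (u c : C) (n : nat) : exp_growing d (fun z => pochn (u + c * z) n).
Proof.
  induction n as [|n IH]; simpl; [apply exp_growing_const|].
  apply (exp_growing_mult (fun z => pochn (u + c * z) n)); auto.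
  assert (E : (fun z => u + c * z + RtoC (INR n))%C = (fun z => (u + RtoC (INR n)) + c * z)%C)
    by (apply functional_extensionality; intros; ring).
  rewrite E. apply exp_growing_affine.
Qed.

Lemma exp_growing_cpowr (x : R) : exp_growing d (cpowr x).
Proof.
  split.
  - intros z Hz. unfold cpowr. apply (Ccont_comp (fun z => z * RtoC (ln x))%C); [|apply Ccont_cexp].
    apply Ccont_mult; [apply Ccont_id|apply Ccont_const].
  - exists 1, (Rabs (ln x)). repeat split; [lra|apply Rabs_pos|].
    intros z Hz. unfold cpowr. rewrite Cmod_cexp, Rmult_1_l.
    assert (B := on_Gplus_Re d z Hz). apply exp_le_mono.
    replace (Re (z * RtoC (ln x))%C) with (ln x * Re z) by (destruct z; simpl; ring).
    apply Rmult_le_compat_r; [lra|apply Rle_abs].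
Qed.

Lemma exp_growing_inv_pochn (u : C) (c rho : R) (n : nat) : 0 < rho -> 0 <= c -> rho <= Re u ->
  exp_growing d (fun z => / pochn (u + RtoC c * z) n)%C.
Proof.
  intros Hr Hc Hu.
  assert (L : forall z k, on_Gplus d z -> rho <= Cmod (u + RtoC c * z + RtoC (INR k))%C).
  { intros z k Hz. eapply Rle_trans; [|apply re_le_Cmod].
    eapply Rle_trans; [|apply Rle_abs].
    assert (B := on_Gplus_Re d z Hz). assert (Pk := pos_INR k).
    destruct z, u; simpl in *. nra. }
  assert (Pz : forall z, on_Gplus d z -> rho ^ n <= Cmod (pochn (u + RtoC c * z) n)).
  { intros z Hz. apply Cmod_pochn_ge; [lra|]. intros k. now apply L. }
  assert (Pr : 0 < rho ^ n) by now apply pow_lt.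
  assert (N0 : forall z, on_Gplus d z -> pochn (u + RtoC c * z) n <> RtoC 0).
  { intros z Hz. apply Cmod_gt_0. specialize (Pz z Hz). lra. }
  split.
  - intros z Hz. apply Ccont_inv; auto.
    apply (Ccont_comp (fun z => u + RtoC c * z)%C (fun v => pochn v n)); [|apply Ccont_pochn].
    apply Ccont_plus; [apply Ccont_const|]. apply Ccont_mult; [apply Ccont_const|apply Ccont_id].
  - exists (/ rho ^ n), 0. repeat split; try lra; [left; now apply Rinv_0_lt_compat|].
    intros z Hz. rewrite Rmult_0_l, exp_0, Rmult_1_r, Cmod_inv by auto.
    apply Rinv_le_contravar; auto.
Qed.

Lemma on_Gplus_shift_left (z : C) (h R0 : R) : on_Gplus d z -> d <= R0 -> 0 < h ->
  R0 + h < Re z ->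
  on_Gplus d (z - RtoC h)%C /\ Rabs (Im (z - RtoC h)%C) = d /\ R0 <= Re (z - RtoC h)%C.
Proof.
  intros Hz HR Hh Hr. destruct z as [a b]. simpl in *.
  destruct Hz as [[H _]|[H K]]; simpl in *; [lra|].
  split; [right; simpl; split; [lra|destruct K; [left|right]; lra]|].
  split; [|lra].
  destruct K as [-> | ->]; [rewrite Rabs_right|rewrite Rabs_left]; lra.
Qed.

(* Iterating the unit-step contraction pushes the compact bound out to infinity with
   arbitrarily fast exponential decay, uniformly in the index. *)
Lemma weighted_cvg_step (h : R) (f : nat -> C -> C) (g : C -> C) : 0 < h ->
  (exists n0, forall n z, (n0 <= n)%nat -> on_Gplus d z -> Ccont (f n) z) ->
  (forall z, on_Gplus d z -> Ccont g z) ->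
  (forall r, exists B, forall z, on_Gplus d z -> Re z <= r -> Cmod (g z) <= B) ->
  (forall r eps, 0 < eps -> exists n0, forall n z, (n0 <= n)%nat -> on_Gplus d z ->
    Re z <= r -> Cmod (f n z - g z)%C <= eps) ->
  (forall q, 0 < q -> exists R0 n0, d <= R0 /\ forall n z, (n0 <= n)%nat -> on_Gplus d z ->
    Rabs (Im z) = d -> R0 <= Re z -> Cmod (f n (z + RtoC h)%C) <= q * Cmod (f n z)) ->
  weighted_cvg d eventually f g.
Proof.
  intros Hh Hcf Hcg Hgb Hcv Hst.
  assert (UB : forall K, 0 <= K -> exists B n0, 0 <= B /\
    (forall n z, (n0 <= n)%nat -> on_Gplus d z -> Cmod (f n z) <= B * exp (- (K * Re z)))).
  { intros K HK.
    (* A contraction by exp(-K h) per step of length h is exactly the decay rate K. *)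
    destruct (Hst (exp (- (K * h))) (exp_pos _)) as [R0 [n0 [HR0 H0]]].
    destruct (Hgb (R0 + h)) as [B0 HB0].
    destruct (Hcv (R0 + h) 1 ltac:(lra)) as [n1 H1].
    assert (PB0 : 0 <= Rabs B0 + 1) by (assert (A := Rabs_pos B0); lra).
    set (B := (Rabs B0 + 1) * exp (K * (R0 + h))).
    assert (PB : 0 <= B) by (apply Rmult_le_pos; [auto|left; apply exp_pos]).
    exists B, (n0 + n1)%nat. split; auto.
    (* Induction over strips of width h: a point beyond R0 + h lies on a ray, and moving it left by
       h keeps it on that ray. The thresholds on n do not depend on the strip, so the bound is
       uniform. *)
    assert (Ind : forall j n z, (n0 + n1 <= n)%nat -> on_Gplus d z ->
      Re z <= R0 + h + INR j * h -> Cmod (f n z) <= B * exp (- (K * Re z))).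
    { induction j as [|j IH]; intros n z Hn Hz Hr.
      - simpl in Hr. rewrite Rmult_0_l, Rplus_0_r in Hr.
        assert (A := H1 n z ltac:(lia) Hz Hr). assert (A' := HB0 z Hz Hr).
        assert (A'' := Rle_abs B0).
        replace (f n z) with ((f n z - g z) + g z)%C by ring.
        eapply Rle_trans; [apply Cmod_triangle|].
        apply Rle_trans with ((Rabs B0 + 1) * 1); [lra|]. unfold B. rewrite Rmult_assoc.
        apply Rmult_le_compat_l; auto. rewrite <- exp_plus, <- exp_0.
        apply exp_le_mono. nra.
      - rewrite S_INR in Hr. destruct (Rle_lt_dec (Re z) (R0 + h)) as [L|L].
        + apply (IH n z Hn Hz). assert (P := pos_INR j). nra.
        + destruct (on_Gplus_shift_left z h R0 Hz HR0 Hh L) as [Z1 [Z2 Z3]].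
          assert (S := H0 n _ ltac:(lia) Z1 Z2 Z3).
          replace (z - RtoC h + RtoC h)%C with z in S by ring.
          assert (Rh : Re (z - RtoC h)%C = Re z - h) by (destruct z; simpl; ring).
          assert (I := IH n _ Hn Z1 ltac:(lra)). rewrite Rh in I.
          eapply Rle_trans; [exact S|].
          eapply Rle_trans; [apply Rmult_le_compat_l; [left; apply exp_pos|exact I]|].
          right. replace (- (K * Re z)) with (- (K * h) + - (K * (Re z - h))) by ring.
          rewrite exp_plus. ring. }
    intros n z Hn Hz. destruct (INR_archimed h (Re z - R0 - h) Hh) as [j Hj].
    apply (Ind j n z Hn Hz). lra. }
  assert (GB : forall K, 0 <= K -> exists B n0, 0 <= B /\
    (forall n z, (n0 <= n)%nat -> on_Gplus d z -> Cmod (f n z) <= B * exp (- (K * Re z))) /\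
    (forall z, on_Gplus d z -> Cmod (g z) <= B * exp (- (K * Re z)))).
  { intros K HK. destruct (UB K HK) as [B [n0 [PB H]]]. exists B, n0. repeat split; auto.
    intros z Hz. apply le_epsilon. intros eps He.
    destruct (Hcv (Re z) eps He) as [n1 H1].
    assert (A := H1 (n0 + n1)%nat z ltac:(lia) Hz ltac:(lra)).
    assert (A' := H (n0 + n1)%nat z ltac:(lia) Hz).
    replace (g z) with (f (n0 + n1)%nat z + - (f (n0 + n1)%nat z - g z))%C by ring.
    eapply Rle_trans; [apply Cmod_triangle|]. rewrite Cmod_opp. lra. }
  split.
  - destruct Hcf as [n0 H]. exists n0. intros n Hn z Hz. now apply H.
  - auto.
  - intros K HK. destruct (GB K HK) as [B [n0 [PB [_ H]]]]. exists B. auto.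
  (* The spare unit of decay makes [f n] and [g] together smaller than eps exp(-K Re z) beyond r';
     up to r' the compact convergence is enough. *)
  - intros K eps HK He. destruct (GB (K + 1) ltac:(lra)) as [B [n0 [PB [H1 H2]]]].
    destruct (exp_opp_small (2 * B) eps ltac:(lra) He) as [r Hr].
    set (r' := Rmax 0 r + 1).
    assert (M1 := Rmax_l 0 r). assert (M2 := Rmax_r 0 r).
    assert (Pe : 0 < eps * exp (- (K * r'))) by (apply Rmult_lt_0_compat; [auto|apply exp_pos]).
    destruct (Hcv r' _ Pe) as [n1 H3].
    exists (n0 + n1)%nat. intros n Hn z Hz.
    destruct (Rle_lt_dec (Re z) r') as [L|L].
    + eapply Rle_trans; [apply H3; auto; lia|].
      apply Rmult_le_compat_l; [lra|]. apply exp_le_mono. nra.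
    + assert (A := H1 n z ltac:(lia) Hz). assert (A' := H2 z Hz).
      eapply Rle_trans; [apply Cmod_triangle_minus|].
      replace (- ((K + 1) * Re z)) with (- Re z + - (K * Re z)) in * by ring.
      rewrite exp_plus in A, A'.
      assert (E := Hr (Re z) ltac:(unfold r' in L; lra)).
      assert (P := exp_pos (- (K * Re z))).
      apply Rle_trans with (2 * B * exp (- Re z) * exp (- (K * Re z))); [lra|].
      apply Rmult_le_compat_r; lra.
Qed.

End Weighted.

(** * The two Gamma factors *)

Definition affine (u c : R) (z : C) : C := (RtoC u + RtoC c * z)%C.

Lemma Re_affine (u c : R) (z : C) : Re (affine u c z) = u + c * Re z.
Proof. unfold affine. destruct z; simpl; ring. Qed.

Lemma Im_affine (u c : R) (z : C) : Im (affine u c z) = c * Im z.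
Proof. unfold affine. destruct z; simpl; ring. Qed.

Lemma Ccont_affine (u c : R) (z : C) : Ccont (affine u c) z.
Proof.
  apply Ccont_plus; [apply Ccont_const|]. apply Ccont_mult; [apply Ccont_const|apply Ccont_id].
Qed.

Section GammaFactors.
Variable d : R.
Hypothesis Hd : 0 < d.

Lemma affine_bounded (u c r : R) : exists R1, 0 <= R1 /\
  forall z, on_Gplus d z -> Re z <= r -> Cmod (affine u c z) <= R1.
Proof.
  assert (P1 := Rabs_pos u). assert (P2 := Rabs_pos c). assert (P3 := Rabs_pos (r + d)).
  exists (Rabs u + Rabs c * Rabs (r + d)). split; [nra|]. intros z Hz Hr.
  unfold affine. eapply Rle_trans; [apply Cmod_triangle|].
  rewrite Cmod_mult, !Cmod_R. apply Rplus_le_compat_l, Rmult_le_compat_l; auto.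
  assert (A := Cmod_on_Gplus d Hd z Hz). assert (B := Rle_abs (r + d)). lra.
Qed.

Lemma affine_dist_plus (u h : R) (z : C) (k : nat) : 0 < h -> on_Gplus d z ->
  u <= Cmod (affine u (/ h) z + RtoC (INR k))%C.
Proof.
  intros Hh Hz. eapply Rle_trans; [|apply re_le_Cmod]. eapply Rle_trans; [|apply Rle_abs].
  replace (Re (affine u (/ h) z + RtoC (INR k))%C) with (Re (affine u (/ h) z) + INR k)
    by (destruct z; simpl; ring).
  rewrite Re_affine. assert (Rz := on_Gplus_Re d z Hz). assert (Pk := pos_INR k).
  assert (0 < / h) by now apply Rinv_0_lt_compat. nra.
Qed.

(** On the vertical segment the real part is at least u - d/h, positive since d < u h. On the rays
    real parts can vanish, but the imaginary part has modulus d/h. Hence the two terms of the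
    minimum. *)
Lemma affine_dist_minus (u h : R) : 0 < h -> d < u * h -> exists rho, 0 < rho /\
  forall z k, on_Gplus d z -> rho <= Cmod (affine u (- / h) z + RtoC (INR k))%C.
Proof.
  intros Hh Hu. assert (Ph : 0 < / h) by now apply Rinv_0_lt_compat.
  exists (Rmin (/ h * d) (u - / h * d)). split.
  - apply Rmin_pos; [nra|].
    assert (/ h * d < / h * (u * h)) by (apply Rmult_lt_compat_l; auto).
    replace (/ h * (u * h)) with u in H by (field; lra). lra.
  - intros z k [[H1 H2]|[H1 H2]].
    + eapply Rle_trans; [apply Rmin_r|].
      eapply Rle_trans; [|apply re_le_Cmod]. eapply Rle_trans; [|apply Rle_abs].
      replace (Re (affine u (- / h) z + RtoC (INR k))%C) with (Re (affine u (- / h) z) + INR k)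
        by (destruct z; simpl; ring).
      rewrite Re_affine, H1. assert (Pk := pos_INR k). lra.
    + eapply Rle_trans; [apply Rmin_l|].
      eapply Rle_trans; [|apply im_le_Cmod].
      replace (Im (affine u (- / h) z + RtoC (INR k))%C) with (Im (affine u (- / h) z))
        by (destruct z; simpl; ring).
      rewrite Im_affine, Rabs_mult, Rabs_Ropp, (Rabs_right (/ h)) by lra.
      apply Rmult_le_compat_l; [lra|].
      destruct H2 as [-> | ->]; [rewrite Rabs_right|rewrite Rabs_left]; lra.
Qed.

Lemma weighted_cvg_rgamma (u h : R) : 0 < u -> 0 < h ->
  weighted_cvg d eventually (fun n z => rgamma_seq n (affine u (/ h) z))
    (fun z => rgamma (affine u (/ h) z)).
Proof.
  intros Hu Hh. assert (Ph : 0 < / h) by now apply Rinv_0_lt_compat.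
  apply (weighted_cvg_step d Hd h); auto.
  - exists 0%nat. intros n z _ _.
    apply (Ccont_comp (affine u (/ h)) (rgamma_seq n)); [apply Ccont_affine|apply Ccont_rgamma_seq].
  - intros z _. apply (Ccont_comp (affine u (/ h)) rgamma); [apply Ccont_affine|apply Ccont_rgamma].
  - intros r. destruct (affine_bounded u (/ h) r) as [R1 [PR HR]].
    destruct (rgamma_seq_error R1 PR) as [D [PD HD]].
    (* The limit is bounded by comparison with the term of index 1, which is v itself. *)
    exists (D + R1). intros z Hz Hr. specialize (HR z Hz Hr).
    specialize (HD 1%nat _ ltac:(lia) HR). rewrite rgamma_seq_1 in HD. simpl INR in HD.
    set (v := affine u (/ h) z) in *.
    replace (rgamma v) with (v - (v - rgamma v))%C by ring.
    eapply Rle_trans; [apply Cmod_triangle_minus|]. unfold Rdiv in HD. rewrite Rinv_1 in HD. lra.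
  - intros r eps He. destruct (affine_bounded u (/ h) r) as [R1 [PR HR]].
    destruct (rgamma_seq_error R1 PR) as [D [PD HD]].
    destruct (INR_archimed_div D eps He) as [n0 [Hn0 Hn0']].
    exists n0. intros n z Hn Hz Hr. specialize (HR z Hz Hr).
    specialize (HD n _ ltac:(lia) HR). specialize (Hn0' n Hn). lra.
  - intros q Hq. destruct (INR_archimed_div 1 (q / 2)) as [n0 [Hn0 Hn0']]; [lra|].
    (* Increasing z by h increases v by 1. The contraction factor 1/v + 1/n is split evenly: R0
       gives |v| >= 2/q, and n0 gives 1/n < q/2. *)
    exists (Rmax d (2 * h / q)), n0. split; [apply Rmax_l|].
    intros n z Hn Hz _ HR. set (v := affine u (/ h) z).
    replace (affine u (/ h) (z + RtoC h)) with (v + 1)%C.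
    2:{ unfold v, affine. rewrite RtoC_inv by lra. field. apply RtoC_neq_0; lra. }
    assert (H1 := INR_ge_1 n ltac:(lia)).
    assert (HR' := Rle_trans _ _ _ (Rmax_r _ _) HR).
    assert (Hv : 2 / q <= Cmod v).
    { eapply Rle_trans; [|apply re_le_Cmod]. eapply Rle_trans; [|apply Rle_abs].
      unfold v. rewrite Re_affine.
      assert (/ h * (2 * h / q) <= / h * Re z) by (apply Rmult_le_compat_l; lra).
      replace (/ h * (2 * h / q)) with (2 / q) in H by (field; lra). lra. }
    assert (P2q : 0 < 2 / q) by (apply Rdiv_lt_0_compat; lra).
    assert (Nv : v <> RtoC 0) by (apply Cmod_gt_0; lra).
    assert (Nn : RtoC (INR n) <> RtoC 0) by (apply RtoC_neq_0; lra).
    replace (rgamma_seq n (v + 1)) with ((/ v + / RtoC (INR n)) * rgamma_seq n v)%C.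
    2:{ assert (E := rgamma_seq_shift n v ltac:(lia)).
        replace (rgamma_seq n (v + 1)) with (/ v * (v * rgamma_seq n (v + 1)))%C by (field; auto).
        rewrite E. field. auto. }
    rewrite Cmod_mult. apply Rmult_le_compat_r; [apply Cmod_ge_0|].
    eapply Rle_trans; [apply Cmod_triangle|].
    rewrite !Cmod_inv, Cmod_RtoC_pos by (auto; lra).
    specialize (Hn0' n Hn). unfold Rdiv in Hn0' at 1. rewrite Rmult_1_l in Hn0'.
    assert (/ Cmod v <= / (2 / q)) by (apply Rinv_le_contravar; lra).
    replace (/ (2 / q)) with (q / 2) in H by (field; lra). lra.
Qed.

(** The limit is Gamma itself, but its argument runs to the left at a distance from the poles, where
    Gamma decays: moving z by h replaces v + 1 by v, and [rgamma_seq_shift] produces the same factor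
    1/v + 1/n. *)
Lemma weighted_cvg_inv_rgamma (u h : R) : 0 < h -> d < u * h ->
  weighted_cvg d eventually (fun n z => / rgamma_seq n (affine u (- / h) z))%C
    (fun z => / rgamma (affine u (- / h) z))%C.
Proof.
  intros Hh Hu. assert (Ph : 0 < / h) by now apply Rinv_0_lt_compat.
  assert (Pu : 0 < u) by nra.
  destruct (affine_dist_minus u h Hh Hu) as [rho [Prho Hrho]].
  assert (Nz : forall z k, on_Gplus d z -> (affine u (- / h) z + RtoC (INR k))%C <> RtoC 0).
  { intros z k Hz. apply Cmod_gt_0. specialize (Hrho z k Hz). lra. }
  assert (Ns : forall n z, on_Gplus d z -> rgamma_seq n (affine u (- / h) z) <> RtoC 0).
  { intros n z Hz. apply rgamma_seq_neq_0. intros k. now apply Nz. }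
  assert (Nr : forall z, on_Gplus d z -> rgamma (affine u (- / h) z) <> RtoC 0).
  { intros z Hz. apply (rgamma_neq_0 _ rho Prho). intros k. now apply Hrho. }
  apply (weighted_cvg_step d Hd h); auto.
  - exists 0%nat. intros n z _ Hz. apply Ccont_inv; auto.
    apply (Ccont_comp (affine u (- / h)) (rgamma_seq n)); [apply Ccont_affine|apply Ccont_rgamma_seq].
  - intros z Hz. apply Ccont_inv; auto.
    apply (Ccont_comp (affine u (- / h)) rgamma); [apply Ccont_affine|apply Ccont_rgamma].
  - intros r. destruct (affine_bounded u (- / h) r) as [R1 [PR HR]].
    destruct (rgamma_lower R1 rho PR Prho) as [c [Pc Hc]].
    exists (/ c). intros z Hz Hr. rewrite Cmod_inv by auto.
    apply Rinv_le_contravar; auto.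
  - intros r eps He. destruct (affine_bounded u (- / h) r) as [R1 [PR HR]].
    destruct (rgamma_seq_error R1 PR) as [D [PD HD]].
    destruct (rgamma_lower R1 rho PR Prho) as [c [Pc Hc]].
    destruct (rgamma_seq_lower R1 rho PR Prho) as [c' [n1 [Pc' [Hn1 Hc']]]].
    destruct (INR_archimed_div (D / (c * c')) eps He) as [n0 [Hn0 Hn0']].
    exists (n0 + n1)%nat. intros n z Hn Hz Hr. specialize (HR z Hz Hr).
    assert (H1 := INR_ge_1 n ltac:(lia)).
    specialize (HD n _ ltac:(lia) HR).
    specialize (Hc _ HR (fun k => Hrho z k Hz)).
    specialize (Hc' n _ ltac:(lia) HR (fun k => Hrho z k Hz)).
    assert (N1 := Ns n z Hz). assert (N2 := Nr z Hz).
    set (v := affine u (- / h) z) in *.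
    replace (/ rgamma_seq n v - / rgamma v)%C
      with (- (rgamma_seq n v - rgamma v) * (/ rgamma v * / rgamma_seq n v))%C by (field; auto).
    rewrite !Cmod_mult, Cmod_opp, !Cmod_inv by auto.
    specialize (Hn0' n ltac:(lia)).
    apply Rle_trans with (D / (c * c') / INR n); [|lra].
    replace (D / (c * c') / INR n) with (D / INR n * (/ c * / c')) by (field; lra).
    apply Rmult_le_compat; auto; [apply Cmod_ge_0| |].
    + apply Rmult_le_pos; left; apply Rinv_0_lt_compat; lra.
    + apply Rmult_le_compat; try (left; apply Rinv_0_lt_compat; lra);
        apply Rinv_le_contravar; lra.
  - intros q Hq. destruct (INR_archimed_div 1 (q / 2)) as [n0 [Hn0 Hn0']]; [lra|].
    (* Chosen so that Re v <= -2/q at the shifted point, which bounds 1/|v| by q/2; the term u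
       compensates the constant part of the argument. *)
    exists (Rmax d (h * (2 / q + u))), n0. split; [apply Rmax_l|].
    intros n z Hn Hz HI HR.
    assert (HR' := Rle_trans _ _ _ (Rmax_r _ _) HR).
    assert (Rz := on_Gplus_Re d z Hz).
    (* Here |Im z| = d matters: an interior point of the vertical segment would leave the contour,
       and might reach a pole, under this translation. *)
    assert (Hz' : on_Gplus d (z + RtoC h)%C).
    { destruct Hz as [Hz|Hz]; right; destruct z as [a b]; simpl in *;
        unfold Rabs in HI; destruct (Rcase_abs b); split; lra. }
    assert (N1 := Ns n z Hz). assert (N2 := Ns n _ Hz').
    set (v := affine u (- / h) (z + RtoC h)) in *.
    assert (Ev : affine u (- / h) z = (v + 1)%C).
    { unfold v, affine. rewrite RtoC_opp, RtoC_inv by lra. field. apply RtoC_neq_0; lra. }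
    rewrite Ev in *.
    assert (H1 := INR_ge_1 n ltac:(lia)).
    assert (P2q : 0 < 2 / q) by (apply Rdiv_lt_0_compat; lra).
    assert (Hv : 2 / q <= Cmod v).
    { eapply Rle_trans; [|apply re_le_Cmod].
      rewrite <- Rabs_Ropp. eapply Rle_trans; [|apply Rle_abs].
      unfold v. rewrite Re_affine.
      replace (Re (z + RtoC h)%C) with (Re z + h) by (destruct z; simpl; ring).
      assert (/ h * (h * (2 / q + u)) <= / h * Re z) by (apply Rmult_le_compat_l; lra).
      replace (/ h * (h * (2 / q + u))) with (2 / q + u) in H by (field; lra).
      assert (0 < / h * h) by nra. lra. }
    assert (Nv : v <> RtoC 0) by (apply Cmod_gt_0; lra).
    assert (Nn : RtoC (INR n) <> RtoC 0) by (apply RtoC_neq_0; lra).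
    replace (/ rgamma_seq n v)%C with ((/ v + / RtoC (INR n)) * / rgamma_seq n (v + 1))%C.
    2:{ assert (E := rgamma_seq_shift n v ltac:(lia)).
        replace ((/ v + / RtoC (INR n)) * / rgamma_seq n (v + 1))%C
          with (rgamma_seq n v * (1 + v / RtoC (INR n)) / (v * rgamma_seq n (v + 1) * rgamma_seq n v))%C
          by (field; auto).
        rewrite <- E. field. auto. }
    rewrite Cmod_mult. apply Rmult_le_compat_r; [apply Cmod_ge_0|].
    eapply Rle_trans; [apply Cmod_triangle|].
    rewrite (Cmod_inv v), (Cmod_inv (RtoC (INR n))), Cmod_RtoC_pos by (auto; lra).
    specialize (Hn0' n Hn). unfold Rdiv in Hn0' at 1. rewrite Rmult_1_l in Hn0'.
    assert (/ Cmod v <= / (2 / q)) by (apply Rinv_le_contravar; lra).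
    replace (/ (2 / q)) with (q / 2) in H by (field; lra). lra.
Qed.

End GammaFactors.

(** * The kernels *)

(** U and V of the overview are its values at theta and eta. Times h it equals (alpha + h)/2, which
    is the form in which d is bounded. *)
Definition base (alpha h : R) : R := alpha / (2 * h) + / 2.

Lemma base_pos (alpha h : R) : 0 <= alpha -> 0 < h -> 0 < base alpha h.
Proof.
  intros Ha Hh. unfold base. assert (0 <= alpha / (2 * h)); [|lra].
  apply Rmult_le_pos; auto. left. apply Rinv_0_lt_compat. lra.
Qed.

Lemma base_mult (alpha h : R) : 0 < h -> base alpha h * h = (alpha + h) / 2.
Proof. intros Hh. unfold base. field. lra. Qed.

(** Carries all dependence on s. The identities (v + p)_(N-p) = (v)_N / (v)_p and 1/Gamma(v + p) =
    1/(Gamma(v) (v)_p) leave the same rational factor in [F_c] and in [F_he]. *)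
Definition shift_factor (alpha eta theta : R) (s : Z) (z : C) : C :=
  (RtoC (eta ^ Z.to_nat (zneg s) / theta ^ Z.to_nat (zpos s))
   * (pochn (affine (base alpha eta) (- / eta) z) (Z.to_nat (zneg s))
      * / pochn (affine (base alpha theta) (/ theta) z) (Z.to_nat (zpos s))))%C.

(* [F_c] without its [s]-independent growth; the index pair is [(M, N)]. *)
Definition amp (alpha eta theta : R) (s : Z) (MN : nat * nat) (z : C) : C :=
  (shift_factor alpha eta theta s z
   * (rgamma_seq (snd MN) (affine (base alpha theta) (/ theta) z)
      * / rgamma_seq (fst MN) (affine (base alpha eta) (- / eta) z)))%C.

Definition amp_lim (alpha eta theta : R) (s : Z) (z : C) : C :=
  (shift_factor alpha eta theta s z
   * (rgamma (affine (base alpha theta) (/ theta) z)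
      * / rgamma (affine (base alpha eta) (- / eta) z)))%C.

(** M and N occur in different factors, each pulled back along a projection of the product filter.
    Poles threaten only through the eta argument, hence the bound on d by eta; the bound by theta
    enters when the lemma is applied with the parameters exchanged. *)
Lemma weighted_cvg_amp (alpha eta theta d : R) (s : Z) (x : R) :
  0 <= alpha -> 0 < eta -> 0 < theta -> 0 < d -> d < (alpha + eta) / 2 ->
  weighted_cvg d (filter_prod eventually eventually)
    (fun MN z => cpowr x z * amp alpha eta theta s MN z)%C
    (fun z => cpowr x z * amp_lim alpha eta theta s z)%C.
Proof.
  intros Ha He Ht Hd Hde.
  assert (B1 := base_pos alpha theta Ha Ht).
  apply (weighted_cvg_growing d); [typeclasses eauto|apply (exp_growing_cpowr d Hd)|].
  apply (weighted_cvg_growing d); [typeclasses eauto| |].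
  - apply exp_growing_mult; [apply exp_growing_const|].
    apply exp_growing_mult; [apply (exp_growing_pochn d Hd)|].
    apply (exp_growing_inv_pochn d Hd _ _ (base alpha theta)); auto; [|simpl; lra].
    left; now apply Rinv_0_lt_compat.
  - apply weighted_cvg_mult; [auto|typeclasses eauto| |].
    + apply (weighted_cvg_comp d eventually _ snd
        (fun n z => rgamma_seq n (affine (base alpha theta) (/ theta) z))); [apply filterlim_snd|].
      now apply weighted_cvg_rgamma.
    + apply (weighted_cvg_comp d eventually _ fst
        (fun n z => / rgamma_seq n (affine (base alpha eta) (- / eta) z))%C); [apply filterlim_fst|].
      apply weighted_cvg_inv_rgamma; auto.
      now rewrite base_mult.
Qed.

(** Invariant under z -> -z with eta and theta exchanged, so the same condition serves both
    contours. A uniform distance [rho] is recorded because nonvanishing of each factor alone does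
    not give the limit statements about [rgamma]. *)
Definition regular (alpha eta theta : R) (z : C) : Prop :=
  exists rho, 0 < rho /\ forall k,
    rho <= Cmod (affine (base alpha theta) (/ theta) z + RtoC (INR k))%C /\
    rho <= Cmod (affine (base alpha eta) (- / eta) z + RtoC (INR k))%C.

Lemma affine_opp (u c : R) (z : C) : affine u c (- z)%C = affine u (- c) z.
Proof. unfold affine. rewrite RtoC_opp. ring. Qed.

Lemma regular_opp (alpha eta theta : R) (z : C) :
  regular alpha eta theta z -> regular alpha theta eta (- z)%C.
Proof.
  intros [rho [Hr H]]. exists rho. split; auto. intros k. destruct (H k) as [H1 H2].
  rewrite !affine_opp, Ropp_involutive. auto.
Qed.

Lemma regular_on_Gplus (alpha eta theta d : R) (z : C) :
  0 <= alpha -> 0 < eta -> 0 < theta -> 0 < d -> d < (alpha + eta) / 2 ->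
  on_Gplus d z -> regular alpha eta theta z.
Proof.
  intros Ha He Ht Hd Hde Hz.
  assert (B1 := base_pos alpha theta Ha Ht).
  destruct (affine_dist_minus d Hd (base alpha eta) eta He) as [rho [Prho Hrho]].
  { now rewrite base_mult. }
  exists (Rmin rho (base alpha theta)). split; [now apply Rmin_pos|].
  intros k. split.
  - eapply Rle_trans; [apply Rmin_r|]. now apply (affine_dist_plus d Hd).
  - eapply Rle_trans; [apply Rmin_l|]. now apply Hrho.
Qed.

Lemma regular_neq_0 (alpha eta theta : R) (z : C) (k : nat) : regular alpha eta theta z ->
  (affine (base alpha theta) (/ theta) z + RtoC (INR k))%C <> RtoC 0 /\
  (affine (base alpha eta) (- / eta) z + RtoC (INR k))%C <> RtoC 0.
Proof.
  intros [rho [Hr H]]. destruct (H k). split; apply Cmod_gt_0; lra.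
Qed.

(** * Factorisation of [F_he] and [F_c] through the amplitudes *)

Lemma pochn_add (v : C) (p n : nat) :
  pochn v (p + n) = (pochn v p * pochn (v + RtoC (INR p)) n)%C.
Proof.
  induction n as [|n IH]; [rewrite Nat.add_0_r; simpl; ring|].
  rewrite Nat.add_succ_r. simpl. rewrite IH, plus_INR, RtoC_plus. ring.
Qed.

Lemma theta_argument (alpha theta : R) (s : Z) (z : C) : 0 < theta -> (0 <= s)%Z ->
  (RtoC (alpha / (2 * theta)) + z / RtoC theta + zC s + half)%C
  = (affine (base alpha theta) (/ theta) z + RtoC (INR (Z.to_nat s)))%C.
Proof.
  intros Ht Hs. unfold affine, base, zC, half.
  rewrite INR_IZR_INZ, Z2Nat.id, RtoC_plus by auto.
  rewrite (RtoC_inv theta) by lra. unfold Cdiv. ring.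
Qed.

Lemma eta_argument (alpha eta : R) (s : Z) (z : C) : 0 < eta -> (0 <= s)%Z ->
  (RtoC (alpha / (2 * eta)) - z / RtoC eta + zC s + half)%C
  = (affine (base alpha eta) (- / eta) z + RtoC (INR (Z.to_nat s)))%C.
Proof.
  intros Ht Hs. unfold affine, base, zC, half.
  rewrite INR_IZR_INZ, Z2Nat.id, RtoC_plus by auto.
  rewrite RtoC_opp, (RtoC_inv eta) by lra. unfold Cdiv. ring.
Qed.

Lemma zpos_nonneg (s : Z) : (0 <= zpos s)%Z.
Proof. unfold zpos; lia. Qed.

Lemma zneg_nonneg (s : Z) : (0 <= zneg s)%Z.
Proof. unfold zneg; lia. Qed.

Lemma powerRZ_nonneg (x : R) (s : Z) : (0 <= s)%Z -> powerRZ x s = x ^ Z.to_nat s.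
Proof. intros H. rewrite <- (Z2Nat.id s) at 1 by auto. symmetry. apply pow_powerRZ. Qed.

Lemma F_he_amp (alpha eta theta : R) (s : Z) (z : C) : 0 < eta -> 0 < theta ->
  regular alpha eta theta z -> F_he alpha eta theta s z = amp_lim alpha eta theta s z.
Proof.
  intros He Ht Hz. unfold F_he, amp_lim, shift_factor.
  rewrite theta_argument, eta_argument by (auto using zpos_nonneg, zneg_nonneg).
  rewrite !powerRZ_nonneg by (auto using zpos_nonneg, zneg_nonneg).
  set (p := Z.to_nat (zpos s)). set (m := Z.to_nat (zneg s)).
  assert (Nz := fun k => regular_neq_0 _ _ _ _ k Hz).
  destruct Hz as [rho [Hr Hz]].
  set (v := affine (base alpha theta) (/ theta) z) in *.
  set (w := affine (base alpha eta) (- / eta) z) in *.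
  assert (Hv : forall k, rho <= Cmod (v + RtoC (INR p) + RtoC (INR k))%C).
  { intros k. rewrite <- Cplus_assoc, <- RtoC_plus, <- plus_INR. apply Hz. }
  assert (Hw : forall k, rho <= Cmod (w + RtoC (INR m) + RtoC (INR k))%C).
  { intros k. rewrite <- Cplus_assoc, <- RtoC_plus, <- plus_INR. apply Hz. }
  rewrite (CGamma_rgamma _ rho Hr Hv), (CGamma_rgamma _ rho Hr Hw).
  rewrite <- (rgamma_shift_pochn v p), <- (rgamma_shift_pochn w m).
  assert (N1 := rgamma_neq_0 _ rho Hr Hv). assert (N2 := rgamma_neq_0 _ rho Hr Hw).
  assert (N3 := pochn_neq_0 v p (fun k => proj1 (Nz k))).
  assert (N4 := pochn_neq_0 w m (fun k => proj2 (Nz k))).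
  field. auto.
Qed.

Definition amp_scale (alpha eta theta : R) (M N : nat) : R :=
  theta ^ N * (INR (fact (pred N)) * exp (base alpha theta * ln (INR N)))
  / (eta ^ M * (INR (fact (pred M)) * exp (base alpha eta * ln (INR M)))).

Lemma amp_scale_pos (alpha eta theta : R) (M N : nat) : 0 < eta -> 0 < theta ->
  0 < amp_scale alpha eta theta M N.
Proof.
  intros He Ht. unfold amp_scale.
  apply Rdiv_lt_0_compat; repeat apply Rmult_lt_0_compat;
    auto using pow_lt, INR_fact_lt_0, exp_pos.
Qed.

Lemma cexp_affine (u c l : R) (z : C) :
  cexp (affine u c z * RtoC l)%C = (RtoC (exp (u * l)) * cexp (z * RtoC (c * l)))%C.
Proof.
  unfold affine. rewrite <- cexp_RtoC, <- cexp_plus, !RtoC_mult. f_equal. ring.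
Qed.

Lemma F_c_amp (alpha eta theta : R) (M N : nat) (s : Z) (z : C) : 0 < eta -> 0 < theta ->
  (zneg s <= Z.of_nat M)%Z -> (zpos s <= Z.of_nat N)%Z -> regular alpha eta theta z ->
  F_c alpha eta theta M N s z =
  (RtoC (amp_scale alpha eta theta M N)
   * (cexp (z * RtoC (/ theta * ln (INR N) + / eta * ln (INR M)))
      * amp alpha eta theta s (M, N) z))%C.
Proof.
  intros He Ht HM HN Hz.
  assert (Zp := zpos_nonneg s). assert (Zn := zneg_nonneg s). unfold F_c, amp, shift_factor, poch. simpl fst; simpl snd.
  rewrite theta_argument, eta_argument by (auto using zpos_nonneg, zneg_nonneg).
  rewrite !powerRZ_nonneg by lia.
  (* The bounds on zpos s and zneg s matter here: for a negative index [poch] would be the empty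
     product. *)
  replace (Z.to_nat (Z.of_nat N - zpos s)) with (N - Z.to_nat (zpos s))%nat by lia.
  replace (Z.to_nat (Z.of_nat M - zneg s)) with (M - Z.to_nat (zneg s))%nat by lia.
  assert (HN' : (Z.to_nat (zpos s) <= N)%nat) by lia.
  assert (HM' : (Z.to_nat (zneg s) <= M)%nat) by lia.
  set (p := Z.to_nat (zpos s)) in *. set (m := Z.to_nat (zneg s)) in *.
  assert (Nz := fun k => regular_neq_0 _ _ _ _ k Hz). clear Hz.
  assert (Ev := cexp_affine (base alpha theta) (/ theta) (ln (INR N)) z).
  assert (Ew := cexp_affine (base alpha eta) (- / eta) (ln (INR M)) z).
  set (v := affine (base alpha theta) (/ theta) z) in *.
  set (w := affine (base alpha eta) (- / eta) z) in *.
  assert (PN := pochn_add v p (N - p)). assert (PM := pochn_add w m (M - m)).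
  replace (p + (N - p))%nat with N in PN by lia. replace (m + (M - m))%nat with M in PM by lia.
  rewrite (pochn_rgamma_seq N v), Ev in PN. rewrite (pochn_rgamma_seq M w), Ew in PM.
  assert (N1 := pochn_neq_0 v p (fun k => proj1 (Nz k))).
  assert (N2 := pochn_neq_0 w m (fun k => proj2 (Nz k))).
  assert (N3 := pochn_neq_0 w M (fun k => proj2 (Nz k))).
  rewrite pochn_rgamma_seq, Ew in N3.
  assert (TN : theta ^ N = theta ^ p * theta ^ (N - p)) by (rewrite <- pow_add; f_equal; lia).
  assert (TM : eta ^ M = eta ^ m * eta ^ (M - m)) by (rewrite <- pow_add; f_equal; lia).
  assert (Q1 := pow_nonzero theta p ltac:(lra)). assert (Q2 := pow_nonzero theta (N - p) ltac:(lra)).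
  assert (Q3 := pow_nonzero eta m ltac:(lra)). assert (Q4 := pow_nonzero eta (M - m) ltac:(lra)).
  unfold amp_scale. rewrite TN, TM.
  set (fN := INR (fact (pred N))) in *. set (fM := INR (fact (pred M))) in *.
  assert (QN : fN <> 0) by apply INR_fact_neq_0. assert (QM : fM <> 0) by apply INR_fact_neq_0.
  set (eN := exp (base alpha theta * ln (INR N))) in *.
  set (eM := exp (base alpha eta * ln (INR M))) in *.
  assert (ReN : eN <> 0) by (unfold eN; assert (A := exp_pos (base alpha theta * ln (INR N))); lra).
  assert (ReM : eM <> 0) by (unfold eM; assert (A := exp_pos (base alpha eta * ln (INR M))); lra).
  (* The eta argument contains -z/eta, so M^(-z/eta) in the denominator becomes M^(z/eta), and the
     two exponentials combine into c^z. *)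
  replace (z * RtoC (/ theta * ln (INR N) + / eta * ln (INR M)))%C
    with (z * RtoC (/ theta * ln (INR N)) + - (z * RtoC (- / eta * ln (INR M))))%C.
  2:{ rewrite RtoC_plus. replace (- / eta * ln (INR M)) with (- (/ eta * ln (INR M))) by ring.
      rewrite RtoC_opp. ring. }
  rewrite cexp_plus, cexp_opp.
  set (cN := cexp (z * RtoC (/ theta * ln (INR N)))) in *.
  set (cM := cexp (z * RtoC (- / eta * ln (INR M)))) in *.
  assert (NcM : cM <> RtoC 0) by apply cexp_neq_0.
  assert (NrM : rgamma_seq M w <> RtoC 0).
  { intros E. apply N3. rewrite E. ring. }
  replace (pochn (v + RtoC (INR p)) (N - p))
    with (RtoC fN * (RtoC eN * cN) * rgamma_seq N v / pochn v p)%C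
    by (rewrite PN; field; auto).
  replace (pochn (w + RtoC (INR m)) (M - m))
    with (RtoC fM * (RtoC eM * cM) * rgamma_seq M w / pochn w m)%C
    by (rewrite PM; field; auto).
  rewrite !RtoC_div, !RtoC_mult by (auto; repeat apply Rmult_integral_contrapositive_currified; auto).
  apply RtoC_neq_0 in Q1, Q2, Q3, Q4, QN, QM, ReN, ReM.
  field. repeat split; auto.
Qed.

(** * Inversion by reflection and exchange of eta and theta *)

Lemma zpos_opp (s : Z) : zpos (- s) = zneg s.
Proof. reflexivity. Qed.

Lemma zneg_opp (s : Z) : zneg (- s) = zpos s.
Proof. unfold zneg, zpos. now rewrite Z.opp_involutive. Qed.

Lemma shift_factor_opp (alpha eta theta : R) (s : Z) (w : C) : 0 < eta -> 0 < theta ->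
  regular alpha theta eta w ->
  (shift_factor alpha eta theta s (- w) * shift_factor alpha theta eta (- s) w)%C = RtoC 1.
Proof.
  intros He Ht Hw. unfold shift_factor.
  rewrite zpos_opp, zneg_opp, !affine_opp, Ropp_involutive.
  assert (Nz := fun k => regular_neq_0 _ _ _ _ k Hw).
  assert (N1 := pochn_neq_0 _ (Z.to_nat (zneg s)) (fun k => proj1 (Nz k))).
  assert (N2 := pochn_neq_0 _ (Z.to_nat (zpos s)) (fun k => proj2 (Nz k))).
  assert (Q1 := pow_nonzero theta (Z.to_nat (zpos s)) ltac:(lra)).
  assert (Q2 := pow_nonzero eta (Z.to_nat (zneg s)) ltac:(lra)).
  rewrite !RtoC_div by auto. apply RtoC_neq_0 in Q1, Q2. field. auto.
Qed.

(** Given as a product equal to 1, the identity also shows that [amp] does not vanish at -w. *)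
Lemma amp_opp (alpha eta theta : R) (s : Z) (M N : nat) (w : C) : 0 < eta -> 0 < theta ->
  regular alpha theta eta w ->
  (amp alpha eta theta s (M, N) (- w) * amp alpha theta eta (- s) (N, M) w)%C = RtoC 1.
Proof.
  intros He Ht Hw. assert (S := shift_factor_opp alpha eta theta s w He Ht Hw).
  unfold amp. simpl. rewrite !affine_opp, Ropp_involutive.
  assert (Nz := fun k => regular_neq_0 _ _ _ _ k Hw).
  assert (N1 := rgamma_seq_neq_0 M _ (fun k => proj1 (Nz k))).
  assert (N2 := rgamma_seq_neq_0 N _ (fun k => proj2 (Nz k))).
  rewrite <- S. field. auto.
Qed.

Lemma amp_lim_opp (alpha eta theta : R) (s : Z) (w : C) : 0 < eta -> 0 < theta ->
  regular alpha theta eta w ->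
  (amp_lim alpha eta theta s (- w) * amp_lim alpha theta eta (- s) w)%C = RtoC 1.
Proof.
  intros He Ht Hw. assert (S := shift_factor_opp alpha eta theta s w He Ht Hw).
  unfold amp_lim. rewrite !affine_opp, Ropp_involutive.
  destruct Hw as [rho [Hr Hw]].
  assert (N1 := rgamma_neq_0 _ rho Hr (fun k => proj1 (Hw k))).
  assert (N2 := rgamma_neq_0 _ rho Hr (fun k => proj2 (Hw k))).
  rewrite <- S. field. auto.
Qed.

(** * Scaling in x and y, and the final estimate *)

Lemma cpowr_opp (x : R) (z : C) : cpowr x (- z)%C = (/ cpowr x z)%C.
Proof. unfold cpowr. rewrite <- cexp_opp. f_equal. ring. Qed.

Lemma cpowr_neq_0 (x : R) (z : C) : cpowr x z <> RtoC 0.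
Proof. apply cexp_neq_0. Qed.

Lemma cpowr_div (x l : R) (z : C) : 0 < x ->
  cpowr (x / exp l) z = (cpowr x z * / cexp (z * RtoC l))%C.
Proof.
  intros Hx. unfold cpowr, Rdiv. rewrite ln_mult, ln_Rinv, ln_exp; auto using exp_pos, Rinv_0_lt_compat.
  rewrite <- cexp_opp, <- cexp_plus. f_equal. rewrite RtoC_plus, RtoC_opp. ring.
Qed.

Lemma sqrt_scaling (x y c : R) : 0 < x -> 0 < y -> 0 < c ->
  / sqrt (x / c * (y / c)) = c * / sqrt (x * y).
Proof.
  intros Hx Hy Hc.
  replace (x / c * (y / c)) with (x * y / (c * c)) by (field; lra).
  assert (P : 0 < x * y) by nra.
  rewrite sqrt_div, sqrt_square by nra.
  assert (0 < sqrt (x * y)) by now apply sqrt_lt_R0. field. lra.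
Qed.

(** The contour integral sees x and y only through x/y, and the test y < x is unchanged by a common
    positive factor; the prefactor 1/sqrt(x y) supplies the single power of c. *)
Lemma V_c_scaling (alpha eta theta : R) (s t : Z) (x y c : R) : 0 < x -> 0 < y -> 0 < c ->
  (RtoC (/ c) * V_c alpha eta theta s (x / c) t (y / c))%C = V_c alpha eta theta s x t y.
Proof.
  intros Hx Hy Hc. unfold V_c. destruct (Z.leb s t); [ring|].
  rewrite sqrt_scaling by auto.
  replace (x / c / (y / c)) with (x / y) by (field; lra).
  assert (Nc : RtoC c <> RtoC 0) by (apply RtoC_neq_0; lra).
  assert (L : y / c < x / c <-> y < x).
  { assert (Pc : 0 < / c) by now apply Rinv_0_lt_compat. unfold Rdiv. split; intros H.
    - now apply Rmult_lt_reg_r in H.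
    - now apply Rmult_lt_compat_r. }
  rewrite RtoC_mult, RtoC_inv by lra.
  destruct (Rlt_dec (y / c) (x / c)), (Rlt_dec y x); try tauto.
  all: rewrite Cmult_assoc, (Cmult_assoc (/ RtoC c)%C), Cinv_l, Cmult_1_l by auto; reflexivity.
Qed.

Lemma weighted_cvg_decaying (d e : R) (a1 a2 : C -> C) (A : R) : 0 <= e ->
  (forall z, on_Gplus d z -> Ccont a1 z) ->
  (forall z, on_Gplus d z -> Cmod (a2 z) <= A * exp (- Re z)) ->
  (forall z, on_Gplus d z -> Cmod (a1 z - a2 z)%C <= e * exp (- Re z)) ->
  exp_decaying d (A + e) a1.
Proof.
  intros He Hc H2 H. split; auto. intros z Hz.
  replace (a1 z) with (a2 z + (a1 z - a2 z))%C by ring.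
  eapply Rle_trans; [apply Cmod_triangle|].
  specialize (H2 z Hz). specialize (H z Hz). lra.
Qed.

(** Extracts the rate 1 needed by the double integral; the higher rates have by then absorbed x^z
    and the rational factors. *)
Lemma weighted_cvg_1 (d : R) {T : Type} (F : (T -> Prop) -> Prop) {FF : Filter F}
  (f : T -> C -> C) (g : C -> C) : weighted_cvg d F f g ->
  exists A, 0 <= A /\ exp_decaying d A g /\ forall e, 0 < e ->
    F (fun t => exp_decaying d (A + e) (f t) /\
      forall z, on_Gplus d z -> Cmod (f t z - g z)%C <= e * exp (- Re z)).
Proof.
  intros [H1 H2 H3 H4]. destruct (H3 1 ltac:(lra)) as [A [PA HA]].
  assert (HA' : forall z, on_Gplus d z -> Cmod (g z) <= A * exp (- Re z)).
  { intros z Hz. specialize (HA z Hz). now rewrite Rmult_1_l in HA. }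
  exists A. split; auto. split; [split; auto|].
  intros e He. generalize (filter_and _ _ H1 (H4 1 e ltac:(lra) He)).
  apply filter_imp. intros t [T1 T2].
  assert (T2' : forall z, on_Gplus d z -> Cmod (f t z - g z)%C <= e * exp (- Re z)).
  { intros z Hz. specialize (T2 z Hz). now rewrite Rmult_1_l in T2. }
  split; auto. apply (weighted_cvg_decaying d e (f t) g A); auto. lra.
Qed.

Theorem mainTheorem4 :
  forall (alpha eta theta d : R),
    0 <= alpha -> 0 < eta -> 0 < theta ->
    0 < d -> d < (alpha + Rmin eta theta) / 2 ->
  forall (s t : Z) (x y : R), 0 < x -> 0 < y ->
  forall eps : R, 0 < eps ->
  exists L : nat, forall M N : nat, (1 <= M)%nat -> (L <= M)%nat -> (M <= N)%nat ->
    let c := Rpower (INR M) (/ eta) * Rpower (INR N) (/ theta) in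
    Cmod (Cminus
            (Cmult (RtoC (/ c)) (K_c alpha eta theta d M N s (x / c) t (y / c)))
            (K_he alpha eta theta d s x t y)) < eps.
Proof.
  intros alpha eta theta d Ha He Ht Hd Hdm s t x y Hx Hy eps Heps.
  assert (Hde : d < (alpha + eta) / 2) by (assert (A := Rmin_l eta theta); lra).
  assert (Hdt : d < (alpha + theta) / 2) by (assert (A := Rmin_r eta theta); lra).
  set (F := filter_prod eventually eventually : (nat * nat -> Prop) -> Prop).
  destruct (weighted_cvg_1 d F _ _ (weighted_cvg_amp alpha eta theta d s x Ha He Ht Hd Hde))
    as [A [PA [DA WA]]].
  (* The w factor, already inverted and reflected: parameters exchanged, t negated, and later
     evaluated at the index pair (N, M). *)
  destruct (weighted_cvg_1 d F _ _ (weighted_cvg_amp alpha theta eta d (- t) y Ha Ht He Hd Hdt))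
    as [B [PB [DB WB]]].
  set (k := (RtoC (/ sqrt (x * y)) * (/ (RtoC (2 * PI) * Ci) * / (RtoC (2 * PI) * Ci)))%C).
  set (Kd := / d * (2 + 2 * d) * (2 + 2 * d)).
  (* With both errors equal to e <= 1, [double_transform_diff] gives at most e (B + 1 + A) Kd; the
     final + 1 makes S positive and the last inequality strict. *)
  set (S := Cmod k * ((B + 1 + A) * Kd) + 1).
  assert (Pk := Cmod_ge_0 k).
  assert (PKd : 0 <= Kd).
  { unfold Kd. assert (0 < / d) by now apply Rinv_0_lt_compat. repeat apply Rmult_le_pos; lra. }
  assert (PS : 0 < S).
  { unfold S. assert (0 <= Cmod k * ((B + 1 + A) * Kd)); [|lra].
    apply Rmult_le_pos; [lra|apply Rmult_le_pos; lra]. }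
  set (e := Rmin 1 (eps / S)).
  assert (Pe : 0 < e) by (unfold e; apply Rmin_pos; [lra|now apply Rdiv_lt_0_compat]).
  assert (e1 : e <= 1) by apply Rmin_l.
  assert (eS : e * S <= eps).
  { apply Rle_trans with (eps / S * S); [|right; field; lra].
    apply Rmult_le_compat_r; [lra|apply Rmin_r]. }
  destruct (WA e Pe) as [Q1 R1 [n1 HQ1] [n2 HR1] HA].
  destruct (WB e Pe) as [Q2 R2 [n3 HQ2] [n4 HR2] HB].
  (* The absolute values of s and t make the Pochhammer lengths in [F_c] nonnegative; M <= N carries
     every threshold over to N. *)
  exists (n1 + n2 + n3 + n4 + Z.to_nat (Z.abs s) + Z.to_nat (Z.abs t))%nat.
  intros M N HM1 HM HN c.
  destruct (HA M N (HQ1 M ltac:(lia)) (HR1 N ltac:(lia))) as [Da Ea].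
  destruct (HB N M (HQ2 N ltac:(lia)) (HR2 M ltac:(lia))) as [Db Eb].
  set (l := / theta * ln (INR N) + / eta * ln (INR M)).
  assert (Ec : c = exp l).
  { unfold c, Rpower, l. rewrite <- exp_plus. f_equal. ring. }
  assert (Pc : 0 < c) by (rewrite Ec; apply exp_pos).
  assert (Rz : forall z, on_Gplus d z -> regular alpha eta theta z)
    by (intros; now apply (regular_on_Gplus alpha eta theta d)).
  assert (Rw : forall w, on_Gplus d w -> regular alpha theta eta w)
    by (intros; now apply (regular_on_Gplus alpha theta eta d)).
  (* The powers of c from (x/c)^z and (y/c)^w cancel the exponentials in [F_c_amp], and the common
     scalar [amp_scale] cancels in the quotient. *)
  assert (E1 : forall z w, on_Gplus d z -> on_Gplus d w ->
    (F_c alpha eta theta M N s z / F_c alpha eta theta M N t (- w)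
      * (cpowr (x / c) z / cpowr (y / c) (- w)))%C
    = (cpowr x z * amp alpha eta theta s (M, N) z
       * (cpowr y w * amp alpha theta eta (- t) (N, M) w))%C).
  { intros z w Hz Hw.
    rewrite (F_c_amp alpha eta theta M N s z) by (auto; unfold zneg, zpos; lia).
    rewrite (F_c_amp alpha eta theta M N t (- w)%C)
      by (auto using regular_opp; unfold zneg, zpos; lia).
    fold l. rewrite Ec, !cpowr_div, cpowr_opp by auto.
    assert (O := amp_opp alpha eta theta t M N w He Ht (Rw w Hw)).
    assert (Na : amp alpha eta theta t (M, N) (- w) <> RtoC 0).
    { intros E. rewrite E, Cmult_0_l in O. apply (RtoC_neq_0 1); [lra|]. now rewrite O. }
    assert (Ny := cpowr_neq_0 y w).
    assert (Ns := RtoC_neq_0 _ (Rgt_not_eq _ _ (amp_scale_pos alpha eta theta M N He Ht))).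
    assert (N1 := cexp_neq_0 (z * RtoC l)%C). assert (N2 := cexp_neq_0 (- w * RtoC l)%C).
    replace (amp alpha theta eta (- t) (N, M) w) with (/ amp alpha eta theta t (M, N) (- w))%C.
    2:{ replace (/ amp alpha eta theta t (M, N) (- w))%C
          with (/ amp alpha eta theta t (M, N) (- w) * RtoC 1)%C by ring.
        rewrite <- O. field. auto. }
    field. repeat split; auto. }
  assert (E2 : forall z w, on_Gplus d z -> on_Gplus d w ->
    (F_he alpha eta theta s z / F_he alpha eta theta t (- w)
      * (cpowr x z / cpowr y (- w)))%C
    = (cpowr x z * amp_lim alpha eta theta s z
       * (cpowr y w * amp_lim alpha theta eta (- t) w))%C).
  { intros z w Hz Hw.
    rewrite (F_he_amp alpha eta theta s z), (F_he_amp alpha eta theta t (- w)%C)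
      by (auto using regular_opp).
    rewrite cpowr_opp.
    assert (O := amp_lim_opp alpha eta theta t w He Ht (Rw w Hw)).
    assert (Na : amp_lim alpha eta theta t (- w) <> RtoC 0).
    { intros E. rewrite E, Cmult_0_l in O. apply (RtoC_neq_0 1); [lra|]. now rewrite O. }
    assert (Ny := cpowr_neq_0 y w).
    replace (amp_lim alpha theta eta (- t) w) with (/ amp_lim alpha eta theta t (- w))%C.
    2:{ replace (/ amp_lim alpha eta theta t (- w))%C
          with (/ amp_lim alpha eta theta t (- w) * RtoC 1)%C by ring.
        rewrite <- O. field. auto. }
    field. auto. }
  assert (K1 := Kdouble_transform d Hd _ _ _ _ (fun z w => F_c alpha eta theta M N s z / F_c alpha eta theta M N t w)%C
    (x / c) (y / c) Da Db E1).
  assert (K2 := Kdouble_transform d Hd _ _ _ _ (fun z w => F_he alpha eta theta s z / F_he alpha eta theta t w)%C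
    x y DA DB E2).
  assert (Dd := double_transform_diff d Hd _ _ _ _ _ _ _ _ _ _ Da DA Db DB Ea Eb).
  unfold K_c, K_he. rewrite K1, K2, sqrt_scaling, RtoC_mult by auto.
  rewrite <- (V_c_scaling alpha eta theta s t x y c) by auto.
  revert Dd. fold Kd.
  generalize (double_transform d (fun z => cpowr x z * amp alpha eta theta s (M, N) z)%C
    (fun w => cpowr y w * amp alpha theta eta (- t) (N, M) w)%C) as D1.
  generalize (double_transform d (fun z => cpowr x z * amp_lim alpha eta theta s z)%C
    (fun w => cpowr y w * amp_lim alpha theta eta (- t) w)%C) as D2.
  generalize (V_c alpha eta theta s (x / c) t (y / c)) as V.
  intros V D2 D1 Dd.
  (* The factor c released by 1/sqrt(x y) cancels the outer 1/c, and the two V terms cancel, so only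
     the difference of the double integrals remains. *)
  assert (E : forall r q : C, (RtoC (/ c) * (RtoC c * r * (q * (q * D1)) - V)
      - (r * (q * (q * D2)) - RtoC (/ c) * V) = r * (q * q) * (D1 - D2))%C).
  { intros r q. rewrite RtoC_inv by lra. field. apply RtoC_neq_0; lra. }
  rewrite E. fold k.
  rewrite Cmod_mult.
  apply Rle_lt_trans with (Cmod k * ((e * (B + e) + A * e) * Kd)).
  - now apply Rmult_le_compat_l.
  - apply Rlt_le_trans with (e * S); auto. unfold S.
    assert (T : (e * (B + e) + A * e) * Kd <= e * ((B + 1 + A) * Kd)).
    { rewrite <- Rmult_assoc. apply Rmult_le_compat_r; auto. nra. }
    apply (Rmult_le_compat_l (Cmod k)) in T; auto. lra.
Qed.
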